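(* Let $r\ge 0$ be an integer congruent to $0$, $1$, $2$ or $4$ modulo $8$, and let $t_1,t_2,t_3\ge0$ be integers (with $r,t_1,t_2,t_3$ not all zero). Then the pseudo $H$-type Lie algebras $\mathfrak n_{r+4t_1+8t_2,\;8t_3+4t_1}$ and $\mathfrak n_{8t_3+4t_1,\;r+4t_1+8t_2}$ are integral isomorphic.
   Context: For integers $r,s\ge 0$ with $r+s\ge1$, $\mathbb R^{r,s}$ is $\mathbb R^{r+s}$ with $\langle Z,W\rangle_{r,s}=\sum_{i=1}^r Z_iW_i-\sum_{j=r+1}^{r+s}Z_jW_j$, and $\mathrm{Cl}_{r,s}$ is the real unital associative algebra generated by $\mathbb R^{r,s}$ subject to $Z\otimes Z=-\langle Z,Z\rangle_{r,s}\,1$. A scalar product is a non-degenerate (possibly indefinite) symmetric bilinear form. An admissible $\mathrm{Cl}_{r,s}$-module is a non-zero finite-dimensional real vector space $\mathfrak v$ with a representation $J:\mathrm{Cl}_{r,s}\to\mathrm{End}(\mathfrak v)$ and a scalar product $\langle\cdot,\cdot\rangle_{\mathfrak v}$ such that $\langle J_Zv,w\rangle_{\mathfrak v}=-\langle v,J_Zw\rangle_{\mathfrak v}$ for all $Z\in\mathbb R^{r,s}$, $v,w\in\mathfrak v$. It is minimal if its dimension is minimal among admissible $\mathrm{Cl}_{r,s}$-modules. The associated pseudo $H$-type Lie algebra is $\mathfrak n=\mathfrak v\oplus\mathbb R^{r,s}$ (orthogonal sum), with center $\mathbb R^{r,s}$ and bracket $[\cdot,\cdot]:\mathfrak v\times\mathfrak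 v\to\mathbb R^{r,s}$ determined by $\langle J_Zv,w\rangle_{\mathfrak v}=\langle Z,[v,w]\rangle_{r,s}$ for all $Z\in\mathbb R^{r,s}$, $v,w\in\mathfrak v$. The notation $\mathfrak n_{r,s}=\mathfrak v_{r,s}\oplus\mathfrak z_{r,s}$, $\mathfrak z_{r,s}=\mathbb R^{r,s}$, stands for the pseudo $H$-type Lie algebra built from a minimal admissible module $\mathfrak v_{r,s}$ (for $s=0$ the scalar product on $\mathfrak v_{r,0}$ is positive definite). Integral basis: a basis $\{v_1,\dots,v_m,Z_1,\dots,Z_n\}$ of a pseudo $H$-type Lie algebra $\mathfrak v\oplus\mathfrak z$, orthonormal (pairwise orthogonal, with $\langle x,x\rangle=\pm1$ for each basis vector $x$), with $v_\alpha\in\mathfrak v$, $Z_k\in\mathfrak z$, such that each $[v_\alpha,v_\beta]$ is either $0$ or $\pm Z_k$ for some $k$, and for all $k,\alpha$ there is exactly one $\beta$ with $[v_\alpha,v_\beta]=\pm Z_k$. Two pseudo $H$-type Lie algebras $\mathfrak n,\tilde{\mathfrak n}$ are integral isomorphic if there are integral bases $\{v_1,\dots,v_m,Z_1,\dots,Z_n\}$ of $\mathfrak n$ and $\{\tilde v_1,\dots,\tilde v_m,\tilde Z_1,\dots,\tilde Z_n\}$ of $\tilde{\mathfrak n}$ and a Lie algebra isomorphism $f:\mathfrak n\to\tilde{\mathfrak n}$ with $f(v_i)=\tilde v_i$ and $f(Z_k)=\tilde Z_k$ for all $i,k$. *)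

(* Defs.v *)
From HB Require Import structures.
From mathcomp Require Import all_boot all_order all_algebra.
From mathcomp Require Import boolp reals.

Set Implicit Arguments.
Unset Strict Implicit.
Unset Printing Implicit Defensive.

Import Order.TTheory GRing.Theory Num.Theory.

Local Open Scope ring_scope.
Local Open Scope quotient_scope.

Definition pdot (R : realType) (r s : nat) (Z W : 'rV[R]_(r + s)) : R :=
  \sum_(i < r) Z 0 (lshift s i) * W 0 (lshift s i)
  - \sum_(j < s) Z 0 (rshift r j) * W 0 (rshift r j).

Section CliffordAlgebra.
Variables (R : realType) (r s : nat).

(* Cl_{r,s} is built from its presentation: formal expressions in scalars and
   vectors, modulo the least congruence [cl_rel] that contains the axioms of
   unital associative R-algebras, the linearity of the generators, and
   Z * Z = - <Z, Z> 1. Opposites and scalings are products by scalars. *)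
Inductive cl_term : Type :=
| CVect of 'rV[R]_(r + s)
| CScal of R
| CAdd of cl_term & cl_term
| CMul of cl_term & cl_term.

Inductive cl_rel : cl_term -> cl_term -> Prop :=
| cl_refl x : cl_rel x x
| cl_sym x y : cl_rel x y -> cl_rel y x
| cl_trans x y z : cl_rel x y -> cl_rel y z -> cl_rel x z
| cl_congD x x' y y' :
    cl_rel x x' -> cl_rel y y' -> cl_rel (CAdd x y) (CAdd x' y')
| cl_congM x x' y y' :
    cl_rel x x' -> cl_rel y y' -> cl_rel (CMul x y) (CMul x' y')
| cl_addA x y z : cl_rel (CAdd x (CAdd y z)) (CAdd (CAdd x y) z)
| cl_addC x y : cl_rel (CAdd x y) (CAdd y x)
| cl_add0 x : cl_rel (CAdd (CScal 0) x) x
| cl_addN x : cl_rel (CAdd (CMul (CScal (-1)) x) x) (CScal 0)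
| cl_mulA x y z : cl_rel (CMul x (CMul y z)) (CMul (CMul x y) z)
| cl_mul1 x : cl_rel (CMul (CScal 1) x) x
| cl_mulDl x y z : cl_rel (CMul (CAdd x y) z) (CAdd (CMul x z) (CMul y z))
| cl_mulDr x y z : cl_rel (CMul x (CAdd y z)) (CAdd (CMul x y) (CMul x z))
| cl_scalD a b : cl_rel (CScal (a + b)) (CAdd (CScal a) (CScal b))
| cl_scalM a b : cl_rel (CScal (a * b)) (CMul (CScal a) (CScal b))
| cl_scalC a x : cl_rel (CMul (CScal a) x) (CMul x (CScal a))
| cl_vectD Z W : cl_rel (CVect (Z + W)) (CAdd (CVect Z) (CVect W))
| cl_vectZ a Z : cl_rel (CVect (a *: Z)) (CMul (CScal a) (CVect Z))
| cl_square Z : cl_rel (CMul (CVect Z) (CVect Z)) (CScal (- pdot Z Z)).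

HB.instance Definition _ := gen_eqMixin cl_term.
HB.instance Definition _ := gen_choiceMixin cl_term.

Definition cl_relb (x y : cl_term) : bool := `[< cl_rel x y >].

Lemma cl_relb_refl : reflexive cl_relb.
Proof. by move=> x; apply/asboolP; apply: cl_refl. Qed.

Lemma cl_relb_sym : symmetric cl_relb.
Proof. by move=> x y; apply/asboolP/asboolP; apply: cl_sym. Qed.

Lemma cl_relb_trans : transitive cl_relb.
Proof.
by move=> y x z /asboolP xy /asboolP yz; apply/asboolP; apply: cl_trans xy yz.
Qed.

Canonical cl_equiv := EquivRel cl_relb cl_relb_refl cl_relb_sym cl_relb_trans.

Definition clifford : Type := {eq_quot cl_equiv}.
HB.instance Definition _ := Choice.on clifford.

Definition cl_class (x : cl_term) : clifford := \pi_{eq_quot cl_equiv} x.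
Definition cl_repr (x : clifford) : cl_term :=
  repr (x : {eq_quot cl_equiv}).

Lemma cl_reprK : cancel cl_repr cl_class.
Proof. exact: reprK. Qed.

Lemma cl_classP x y : cl_class x = cl_class y <-> cl_rel x y.
Proof.
split=> [/eqP|xy]; first by rewrite eqmodE => /asboolP.
by apply/eqP; rewrite eqmodE; apply/asboolP.
Qed.

Lemma cl_classK x : cl_rel (cl_repr (cl_class x)) x.
Proof. by apply/cl_classP; rewrite cl_reprK. Qed.

Lemma cl_classW (P : clifford -> Prop) :
  (forall x, P (cl_class x)) -> forall x, P x.
Proof. by move=> Pc x; rewrite -[x]cl_reprK. Qed.

Definition cl_vect (Z : 'rV[R]_(r + s)) : clifford := cl_class (CVect Z).
Definition cl_scal (a : R) : clifford := cl_class (CScal a).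
Definition cl_add (x y : clifford) : clifford :=
  cl_class (CAdd (cl_repr x) (cl_repr y)).
Definition cl_mul (x y : clifford) : clifford :=
  cl_class (CMul (cl_repr x) (cl_repr y)).
Definition cl_opp (x : clifford) : clifford := cl_mul (cl_scal (-1)) x.
Definition cl_scale (a : R) (x : clifford) : clifford := cl_mul (cl_scal a) x.

Lemma cl_addE x y : cl_add (cl_class x) (cl_class y) = cl_class (CAdd x y).
Proof. by apply/cl_classP; apply: cl_congD; apply: cl_classK. Qed.

Lemma cl_mulE x y : cl_mul (cl_class x) (cl_class y) = cl_class (CMul x y).
Proof. by apply/cl_classP; apply: cl_congM; apply: cl_classK. Qed.

Let opsE := (cl_mulE, cl_addE).

Fact clifford_addA : associative cl_add.
Proof.
elim/cl_classW=> x; elim/cl_classW=> y; elim/cl_classW=> z.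
by rewrite !opsE; apply/cl_classP/cl_addA.
Qed.

Fact clifford_addC : commutative cl_add.
Proof.
elim/cl_classW=> x; elim/cl_classW=> y.
by rewrite !opsE; apply/cl_classP/cl_addC.
Qed.

Fact clifford_add0 : left_id (cl_scal 0) cl_add.
Proof. by elim/cl_classW=> x; rewrite opsE; apply/cl_classP/cl_add0. Qed.

Fact clifford_addN : left_inverse (cl_scal 0) cl_opp cl_add.
Proof.
by elim/cl_classW=> x; rewrite /cl_opp cl_mulE cl_addE; apply/cl_classP/cl_addN.
Qed.

Fact clifford_mulA : associative cl_mul.
Proof.
elim/cl_classW=> x; elim/cl_classW=> y; elim/cl_classW=> z.
by rewrite !opsE; apply/cl_classP/cl_mulA.
Qed.

Fact clifford_mul1l : left_id (cl_scal 1) cl_mul.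
Proof. by elim/cl_classW=> x; rewrite opsE; apply/cl_classP/cl_mul1. Qed.

Fact clifford_scalC a x : cl_mul (cl_scal a) x = cl_mul x (cl_scal a).
Proof. by elim/cl_classW: x => x; rewrite !opsE; apply/cl_classP/cl_scalC. Qed.

Fact clifford_mul1r : right_id (cl_scal 1) cl_mul.
Proof. by move=> x; rewrite -clifford_scalC clifford_mul1l. Qed.

Fact clifford_mulDl : left_distributive cl_mul cl_add.
Proof.
elim/cl_classW=> x; elim/cl_classW=> y; elim/cl_classW=> z.
by rewrite !opsE; apply/cl_classP/cl_mulDl.
Qed.

Fact clifford_mulDr : right_distributive cl_mul cl_add.
Proof.
elim/cl_classW=> x; elim/cl_classW=> y; elim/cl_classW=> z.
by rewrite !opsE; apply/cl_classP/cl_mulDr.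
Qed.

Fact clifford_scalD a b : cl_scal (a + b) = cl_add (cl_scal a) (cl_scal b).
Proof. by rewrite opsE; apply/cl_classP/cl_scalD. Qed.

Fact clifford_scalM a b : cl_scal (a * b) = cl_mul (cl_scal a) (cl_scal b).
Proof. by rewrite opsE; apply/cl_classP/cl_scalM. Qed.

HB.instance Definition _ := GRing.isPzRing.Build clifford
  clifford_addA clifford_addC clifford_add0 clifford_addN
  clifford_mulA clifford_mul1l clifford_mul1r clifford_mulDl clifford_mulDr.

Fact clifford_scaleA a b x : cl_scale a (cl_scale b x) = cl_scale (a * b) x.
Proof. by rewrite /cl_scale clifford_scalM clifford_mulA. Qed.

Fact clifford_scaleDr : right_distributive cl_scale +%R.
Proof. by move=> a x y; apply: clifford_mulDr. Qed.

Fact clifford_scaleDl x : {morph cl_scale^~ x : a b / a + b}.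
Proof. by move=> a b; rewrite /cl_scale clifford_scalD clifford_mulDl. Qed.

HB.instance Definition _ := GRing.Zmodule_isLmodule.Build R clifford
  clifford_scaleA clifford_mul1l clifford_scaleDr clifford_scaleDl.

Lemma clifford_scaleAl a (x y : clifford) : a *: (x * y) = (a *: x) * y.
Proof. exact: clifford_mulA. Qed.

Lemma clifford_scaleAr a (x y : clifford) : a *: (x * y) = x * (a *: y).
Proof.
rewrite clifford_scaleAl -[a *: x]/(cl_mul _ x) clifford_scalC.
by rewrite -[LHS]clifford_mulA.
Qed.

Fact cl_vect_is_linear : linear cl_vect.
Proof.
move=> a Z W; rewrite -[RHS]/(cl_add (cl_mul (cl_scal a) _) _) cl_mulE cl_addE.
apply/cl_classP; apply: cl_trans (cl_vectD _ _) _.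
by apply: cl_congD (cl_vectZ _ _) (cl_refl _).
Qed.

HB.instance Definition _ := GRing.isLinear.Build R _ clifford _ cl_vect
  cl_vect_is_linear.

Lemma cl_vect_square Z : cl_vect Z * cl_vect Z = - pdot Z Z *: (1 : clifford).
Proof.
rewrite -[RHS]/(cl_mul (cl_scal _) (cl_scal 1)) clifford_mul1r.
by rewrite -[LHS]/(cl_mul _ _) opsE; apply/cl_classP/cl_square.
Qed.

End CliffordAlgebra.

Record cl_representation (R : realType) (r s : nat) (V : vectType R) :=
  ClRepresentation {
    cl_rep :> {linear clifford R r s -> 'End(V)};
    cl_rep1 : cl_rep 1 = \1%VF;
    cl_repM : forall x y, cl_rep (x * y) = (cl_rep x \o cl_rep y)%VF }.

(* Universal property of the presentation: maps on generators that satisfy the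
   Clifford relation extend uniquely to representations. *)
Lemma cl_representation_extend (R : realType) (r s : nat) (V : vectType R)
    (j : {linear 'rV[R]_(r + s) -> 'End(V)}) :
    (forall Z, (j Z \o j Z)%VF = - pdot Z Z *: \1%VF) ->
  exists J : cl_representation r s V, forall Z, J (cl_vect Z) = j Z.
Proof.
move=> jj.
pose ev := fix ev (x : cl_term R r s) : 'End(V) := match x with
  | CVect Z => j Z
  | CScal a => a *: \1%VF
  | CAdd x y => ev x + ev y
  | CMul x y => (ev x \o ev y)%VF
  end.
have evP x y : cl_rel x y -> ev x = ev y.
  elim=> {x y} //=.
  - by move=> x y z _ -> _ ->.
  - by move=> x x' y y' _ -> _ ->.
  - by move=> x x' y y' _ -> _ ->.
  - by move=> x y z; rewrite addrA.
  - by move=> x y; rewrite addrC.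
  - by move=> x; rewrite scale0r add0r.
  - by move=> x; rewrite -comp_lfunZl comp_lfun1l scaleN1r addNr scale0r.
  - by move=> x y z; rewrite comp_lfunA.
  - by move=> x; rewrite scale1r comp_lfun1l.
  - by move=> x y z; rewrite comp_lfunDl.
  - by move=> x y z; rewrite comp_lfunDr.
  - by move=> a b; rewrite scalerDl.
  - by move=> a b; rewrite -comp_lfunZl comp_lfun1l scalerA.
  - by move=> a x; rewrite -comp_lfunZl -comp_lfunZr comp_lfun1l comp_lfun1r.
  - by move=> Z W; rewrite raddfD.
  - by move=> a Z; rewrite linearZ /= -comp_lfunZl comp_lfun1l.
pose f (x : clifford R r s) := ev (cl_repr x).
have fE x : f (cl_class x) = ev x by apply/evP/cl_classK.
have f_lin : linear f.
  move=> a x y; rewrite -[a *: x + y]/(cl_class _) fE /= /f.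
  by rewrite (evP _ _ (cl_classK _)) /= (evP _ _ (cl_classK _)) /=
    -comp_lfunZl comp_lfun1l.
pose fL := HB.pack_for {linear clifford R r s -> 'End(V)} f
  (GRing.isLinear.Build _ _ _ _ f f_lin).
have f1 : fL 1 = \1%VF by rewrite -[LHS]/(f (cl_class _)) fE /= scale1r.
have fM x y : fL (x * y) = (fL x \o fL y)%VF.
  by rewrite -[LHS]/(f (cl_class _)) fE.
by exists (ClRepresentation f1 fM) => Z; apply: fE.
Qed.

Lemma cl_representation_uniq (R : realType) (r s : nat) (V : vectType R)
    (J J' : cl_representation r s V) :
  (forall Z, J (cl_vect Z) = J' (cl_vect Z)) -> J =1 J'.
Proof.
move=> JJ'; elim/cl_classW; elim=> [Z|a|x IHx y IHy|x IHx y IHy].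
- exact: JJ'.
- rewrite -[cl_class _](@clifford_mul1r R r s).
  by rewrite -[cl_mul _ _]/(a *: (1 : clifford R r s)) !linearZ /= !cl_rep1.
- by rewrite -cl_addE -[cl_add _ _]/(cl_class x + cl_class y) !raddfD /= IHx IHy.
- by rewrite -cl_mulE -[cl_mul _ _]/(cl_class x * cl_class y) !cl_repM IHx IHy.
Qed.

Record admissible_module (R : realType) (r s : nat) := AdmissibleModule {
  am_space :> vectType R;
  am_nonzero : (0 < \dim {:am_space})%N;
  am_rep : cl_representation r s am_space;
  am_form : {symmetric am_space};
  am_nondegenerate : nondegenerate am_form;
  am_skew : forall (Z : 'rV[R]_(r + s)) (v w : am_space),
    am_form (am_rep (cl_vect Z) v) w = - am_form v (am_rep (cl_vect Z) w) }.

Section PseudoHType.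
Variables (R : realType) (r s : nat).
Implicit Types M : admissible_module R r s.

(* The last clause is the convention that the scalar product of v_{r,0} is
   positive definite. *)
Definition minimal_admissible M : Prop :=
  (forall M' : admissible_module R r s, (\dim {:M} <= \dim {:M'})%N)
  /\ (s = 0%N -> forall v : M, v != 0 -> 0 < am_form M v v).

(* The coordinates of [v, w] are those that [brackP] forces: the basis vectors
   of R^{r,s} square to 1 for i < r and to -1 for r <= i. *)
Definition brack M (v w : M) : 'rV[R]_(r + s) :=
  \row_(i < r + s)
    ((-1) ^+ (r <= i)%N * am_form M (am_rep M (cl_vect (delta_mx 0 i)) v) w).

Lemma pdot_delta i (W : 'rV[R]_(r + s)) :
  pdot (delta_mx 0 i) W = (-1) ^+ (r <= i)%N * W 0 i.
Proof.
rewrite /pdot; case: (split_ordP i) => k ->.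
  rewrite (bigD1 k) //= mxE !eqxx mul1r big1 ?addr0 => [|i' i'k].
    rewrite big1 ?subr0 => [|j _]; last by rewrite mxE eq_rlshift mul0r.
    by rewrite leqNgt ltn_ord expr0 mul1r.
  by rewrite mxE eq_lshift eq_sym (negPf (_ : k != i')) ?mul0r // eq_sym.
rewrite big1 => [|i' _]; last by rewrite mxE eq_lrshift mul0r.
rewrite (bigD1 k) //= mxE !eqxx mul1r big1 ?addr0 => [|j jk].
  by rewrite sub0r leq_addr expr1 mulN1r.
by rewrite mxE eq_rshift (negPf jk) mul0r.
Qed.

Lemma pdotZl (a : R) (Z W : 'rV[R]_(r + s)) : pdot (a *: Z) W = a * pdot Z W.
Proof.
rewrite /pdot mulrBr !mulr_sumr.
by congr (_ - _); apply: eq_bigr => i _; rewrite mxE mulrA.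
Qed.

Lemma pdotDl (Z Z' W : 'rV[R]_(r + s)) :
  pdot (Z + Z') W = pdot Z W + pdot Z' W.
Proof.
rewrite /pdot addrACA -opprD -!big_split.
by congr (_ - _); apply: eq_bigr => i _; rewrite mxE mulrDl.
Qed.

Lemma brackP M (Z : 'rV[R]_(r + s)) (v w : M) :
  am_form M (am_rep M (cl_vect Z) v) w = pdot Z (brack v w).
Proof.
rewrite [Z]row_sum_delta.
apply: (big_ind (fun Y => am_form M (am_rep M (cl_vect Y) v) w
                          = pdot Y (brack v w))) => [|Y Y' IHY IHY'|i _].
- by rewrite !raddf0 zero_lfunE linear0l -(scale0r 0) pdotZl mul0r.
- rewrite !raddfD /= add_lfunE linearDl pdotDl; exact: congr2 IHY IHY'.
rewrite !linearZ /= scale_lfunE linearZl_LR /= pdotZl pdot_delta mxE.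
by rewrite signrMK.
Qed.

Lemma brack_uniq M (v w : M) (X : 'rV[R]_(r + s)) :
    (forall Z, am_form M (am_rep M (cl_vect Z) v) w = pdot Z X) ->
  X = brack v w.
Proof.
move=> XP; apply/rowP=> i; have := XP (delta_mx 0 i).
by rewrite brackP !pdot_delta => /(can_inj (signrMK _)) ->.
Qed.

Definition pseudoH M : vectType R := (M * 'rV[R]_(r + s))%type.
Definition in_v M (v : M) : pseudoH M := (v, 0).
Definition in_z M (Z : 'rV[R]_(r + s)) : pseudoH M := (0, Z).

Definition lie M (x y : pseudoH M) : pseudoH M := in_z M (brack x.1 y.1).
Definition pseudoH_form M (x y : pseudoH M) : R :=
  am_form M x.1 y.1 + pdot x.2 y.2.

Definition is_pm M (x y : pseudoH M) : Prop := x = y \/ x = - y.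

Definition integral_basis M (m n : nat)
    (v : m.-tuple M) (Z : n.-tuple 'rV[R]_(r + s)) : Prop :=
  let b := [seq in_v x | x <- v] ++ [seq in_z M z | z <- Z] in
  [/\ basis_of {:pseudoH M} b,
      pairwise (fun x y => pseudoH_form x y == 0) b,
      {in b, forall x, pseudoH_form x x = 1 \/ pseudoH_form x x = -1},
      (forall a c : 'I_m,
         let x := lie (in_v (tnth v a)) (in_v (tnth v c)) in
         x = 0 \/ exists k : 'I_n, is_pm x (in_z M (tnth Z k)))
    & (forall (k : 'I_n) (a : 'I_m), exists! c : 'I_m,
         is_pm (lie (in_v (tnth v a)) (in_v (tnth v c))) (in_z M (tnth Z k)))].

End PseudoHType.

Definition integral_isomorphic (R : realType) (r s r' s' : nat)
    (M : admissible_module R r s) (M' : admissible_module R r' s') : Prop :=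
  exists (m n : nat)
    (v : m.-tuple M) (Z : n.-tuple 'rV[R]_(r + s))
    (v' : m.-tuple M') (Z' : n.-tuple 'rV[R]_(r' + s'))
    (f : {linear pseudoH M -> pseudoH M'}),
    [/\ integral_basis v Z /\ integral_basis v' Z',
        bijective f,
        (forall x y : pseudoH M, f (lie x y) = lie (f x) (f y)),
        (forall i : 'I_m, f (in_v (tnth v i)) = in_v (tnth v' i))
      & (forall k : 'I_n, f (in_z M (tnth Z k)) = in_z M' (tnth Z' k))].

(* Main.v *)
Require Import Defs.
From HB Require Import structures.
From mathcomp Require Import all_boot all_order all_algebra.
From mathcomp Require Import boolp reals lra zify.

Set Implicit Arguments.
Unset Strict Implicit.
Unset Printing Implicit Defensive.

Import Order.TTheory GRing.Theory Num.Theory.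

Local Open Scope ring_scope.

(** Write J_i for the action of the i-th standard generator, and for a word
    T, that is a subset of the generators seen as an element of F_2^n, let
    J_T be the ordered product of the J_i with i in T. Up to signs, T |-> J_T
    is additive.

    The signature enters through a linear code L of F_2^n whose words have
    weight divisible by 4 and meet the positive generators evenly: for S in L
    the operators J_S are commuting self-adjoint involutions, hence have a
    common eigenvector v, which can be normalized to <v, v> = 1 or -1
    ([ex_eigenvector]). The line spanned by J_T v depends only on T modulo L.
    Assume moreover that a word T outside L either overlaps some word of L
    oddly, or has weight 1 or 2 modulo 4. Then <v, J_T v> = 0: in the first
    case J_S fixes v up to sign and anticommutes with J_T, in the second case
    J_T is skew ([eigenvector_orth]). So the J_T v, for T in a transversal of
    L, are an orthonormal basis of a nondegenerate submodule, which is the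
    whole module when that is minimal ([minimal_frame_basis]). Together with
    the standard basis of the centre this basis is integral: [J_T v, J_U v]
    is plus or minus Z_k when T + U + k is in L, which happens for at most
    one k since two such k would give a word of weight 2 in L
    ([frame_integral_basis]).

    Exchanging r and s replaces each J_i^2 by its opposite, and the same code
    L serves both signatures because its words have even weight. The
    eigenvalues of the two eigenvectors v and v' differ by a character of L,
    which counts the overlaps with some word T modulo 2 ([character_ip]);
    replacing v' by J'_T v' makes them equal ([matched_eigenvectors]). The
    comparison is then guided by the parity operator D on the first module, D
    (J_T v) = (-1)^|T| J_T v. It is well defined since L is even, it
    anticommutes with the J_i, so the D J_i satisfy the relations of the
    opposite signature, and the form <D x, y> turns them into generators of
    an admissible module with, up to a global sign, the same structure
    constants. In coordinates: after the rescaling [frame_vect] of the basis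
    of the second module, the numbers <J_i x_T, x_U> agree up to one global
    sign ([frame_compare]), which the generators of the centre absorb
    ([integral_isomorphic_of_code]).

    For the signatures at hand the number of generators is r0 + 8 K with r0
    in {0, 1, 2, 4}, and after the first r0 generators the signature is
    constant on runs of length 4. The code is a direct sum of K extended
    Hamming codes and, if r0 = 4, of the repetition code of length 4. The
    Hamming codes are self-dual, and for the remaining r0 generators a word
    of even overlap with the code and outside it has weight 1 or 2
    ([good_code_small]). This is where the residues 0, 1, 2, 4 come from. *)

(** * Words over F_2 *)

Lemma odd_uphalf n : odd (uphalf n) = odd n (+) odd n./2.
Proof. by rewrite uphalf_half oddD oddb. Qed.

Section Words.
Variable I : finType.
Local Notation word := {ffun I -> bool}.
Implicit Types (S T U : word) (i j : I).

Definition single i : word := [ffun j => j == i].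
Definition wt T : nat := #|[set i | T i]|.

(** The sum is taken in the field bool, so this is the standard bilinear form
    of F_2^I: the parity of the common support. *)
Definition ip S T : bool := \sum_i (S i && T i).

Lemma wordD S T i : (S + T) i = S i (+) T i. Proof. by rewrite ffunE. Qed.
Lemma word0 i : (0 : word) i = false. Proof. by rewrite ffunE. Qed.
Lemma wordDD T : T + T = 0.
Proof. by apply/ffunP => i; rewrite wordD word0 addbb. Qed.
Lemma wordK T : involutive (fun S => S + T).
Proof. by move=> S; rewrite -addrA wordDD addr0. Qed.

Lemma wt0 : wt 0 = 0%N.
Proof. by apply: eq_card0 => i; rewrite !inE word0. Qed.

Lemma wt_add_single T i : ~~ T i -> wt (T + single i) = (wt T).+1.
Proof.
move=> Ti; rewrite /wt; have := cardsU1 i [set j | T j].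
rewrite inE Ti add1n => <-; apply: eq_card => j; rewrite !inE wordD ffunE.
by case: eqP => [->|_]; rewrite ?(negPf Ti) ?addbF ?orbF.
Qed.

(** Words are built by switching letters on; only this case of adding a
    letter has to be checked in the sign computations below. *)
Lemma word_ind (P : word -> Prop) :
  P 0 -> (forall i T, ~~ T i -> P T -> P (T + single i)) -> forall T, P T.
Proof.
move=> P0 PS T; have [n] := ubnP (wt T); elim: n T => // n IHn T.
case: (pickP T) => [i Ti|T0] leT; last first.
  by rewrite (_ : T = 0) //; apply/ffunP => i; rewrite T0 word0.
have Ti' : ~~ (T + single i) i by rewrite wordD Ti ffunE eqxx.
rewrite -[T](wordK (single i)); apply: PS => //; apply: IHn.
by move: leT; rewrite -{1}[T](wordK (single i)) wt_add_single.
Qed.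

Lemma odd_wtD S T : odd (wt (S + T)) = odd (wt S) (+) odd (wt T).
Proof.
have odd_wt U : odd (wt U) = \sum_i U i :> bool.
  elim/word_ind: U => [|i U Ui IH].
    by rewrite wt0 big1 // => i _; rewrite word0.
  rewrite wt_add_single //= IH; under eq_bigr do rewrite wordD.
  rewrite -[RHS]/(\sum_j (U j + single i j)) big_split /=.
  rewrite [X in _ = _ + X](bigD1 i) //= ffunE eqxx [X in _ = _ + (_ + X)]big1
    ?addr0.
    by rewrite -[RHS]/(_ (+) true) addbT.
  by move=> j; rewrite ffunE => /negPf ->.
rewrite !odd_wt -[RHS]/((_ : bool) + _) -big_split /=.
by apply: eq_bigr => i _; rewrite wordD.
Qed.

Lemma ipDl S S' T : ip (S + S') T = ip S T (+) ip S' T.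
Proof.
rewrite /ip -[RHS]/((_ : bool) + _) -big_split /=.
by apply: eq_bigr => i _; rewrite wordD andb_addl.
Qed.

Lemma ipC S T : ip S T = ip T S.
Proof. by apply: eq_bigr => i _; rewrite andbC. Qed.

Lemma ip0l T : ip 0 T = false.
Proof. by rewrite /ip big1 // => i _; rewrite word0. Qed.

Lemma ip_single i T : ip (single i) T = T i.
Proof.
rewrite /ip (bigD1 i) //= ffunE eqxx big1 ?addr0 // => j.
by rewrite ffunE => /negPf ->.
Qed.

End Words.

(** * Doubly even codes *)

Section Code.
Variable I : finType.
Local Notation word := {ffun I -> bool}.
Implicit Types (S T U : word) (i j : I) (e : I -> bool).

(** The weight of S + T is wt S + wt T - 2 #(S /\ T); this is that equality
    modulo 4, read off the second binary digit. *)
Lemma odd_half_wtD S T :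
  odd (wt (S + T))./2
  = odd (wt S)./2 (+) odd (wt T)./2 (+) (ip S T (+) (odd (wt S) && odd (wt T))).
Proof.
elim/word_ind: S => [|i S Si IH].
  by rewrite add0r ip0l wt0 /= addbF.
rewrite addrAC ipDl ip_single wt_add_single //= odd_uphalf.
have := odd_wtD S T; case STi : ((S + T) i); move: (STi);
  rewrite wordD (negPf Si) /= => ->.
  have STi' : ~~ (S + T + single i) i by rewrite wordD STi ffunE eqxx.
  move: IH; rewrite -{1 2}[S + T](wordK (single i)) wt_add_single //=
    odd_uphalf.
  set a := odd (wt (_ + single i)); set b := odd _./2 => /= + abe.
  have -> : a = ~~ (odd (wt S) (+) odd (wt T)) by rewrite -abe negbK.
  by case: b; case: (odd _./2); case: (odd _./2); case: (ip _ _);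
    case: (odd _); case: (odd _).
rewrite wt_add_single ?STi //= odd_uphalf IH => ->.
by case: (odd _./2); case: (odd _./2); case: (ip _ _); case: (odd _);
  case: (odd _).
Qed.

(** The first four conditions make the J_S, for S in L, commuting
    self-adjoint involutions when e marks the generators of square -1. In
    [code_max], the number uphalf (wt T) is odd exactly when wt T is 1 or 2
    modulo 4, that is when J_T is skew; the condition forces <v, J_T v> = 0
    for eigenvectors v. *)
Record good_code e (L : pred word) : Prop := GoodCode {
  code0 : L 0;
  codeD : forall S T, L S -> L T -> L (S + T);
  code_wt : forall S, L S -> (4 %| wt S)%N;
  code_even : forall S, L S -> \sum_i (S i && e i) = false;
  code_max : forall T, ~~ L T -> (exists2 S, L S & ip S T) \/ odd (uphalf (wt
    T)) }.

Section GoodCodeTheory.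
Variables (e : I -> bool) (L : pred word).
Hypothesis goodL : good_code e L.

Lemma code_odd S : L S -> odd (wt S) = false.
Proof. by move/(code_wt goodL)/dvdnP => [k ->]; rewrite oddM andbF. Qed.

Lemma code_odd_half S : L S -> odd (wt S)./2 = false.
Proof.
move/(code_wt goodL)/dvdnP => [k ->].
by rewrite (_ : (k * 4 = (k * 2).*2)%N) ?doubleK ?oddM ?andbF // -muln2 -mulnA.
Qed.

Lemma code_odd_uphalf S : L S -> odd (uphalf (wt S)) = false.
Proof. by move=> LS; rewrite odd_uphalf code_odd ?code_odd_half. Qed.

(** Since S, T and S + T have weight divisible by 4, only the term ip S T is
    left in [odd_half_wtD]. *)
Lemma code_ip S T : L S -> L T -> ip S T = false.
Proof.
move=> LS LT; have := odd_half_wtD S T.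
by rewrite !code_odd_half ?(codeD goodL) // !code_odd //= addbF.
Qed.

End GoodCodeTheory.

Lemma add_self_eq0 (F : numDomainType) (x : F) : x + x = 0 -> x = 0.
Proof. by move/eqP; rewrite -mulr2n mulrn_eq0 => /eqP. Qed.

(** Characters of a subgroup of F_2^I extend to F_2^I. The proof counts: the
    sum of (-1)^(psi S + ip S T) over all T and all S in L is the number of
    words, as the terms with S <> 0 cancel over T. So the inner sum over L is
    nonzero for some T, and a character with nonzero sum is trivial. *)
Lemma character_ip (L : pred word) (psi : word -> bool) :
    L 0 -> (forall S T, L S -> L T -> L (S + T)) ->
    (forall S T, L S -> L T -> psi (S + T) = psi S (+) psi T) ->
  exists T, forall S, L S -> ip S T = psi S.
Proof.
move=> L0 LD psiD.
pose f (S T : word) : int := (-1) ^+ (psi S (+) ip S T).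
have sumT S : \sum_T f S T = (S == 0)%:R * #|{: word}|%:R.
  have [->|] := eqVneq S 0.
    have psi0 : psi 0 = false by have := psiD 0 0 L0 L0; rewrite addr0 addbb.
    rewrite mul1r -sumr_const; apply: eq_bigr => T _.
    by rewrite /f ip0l psi0.
  rewrite mul0r => S0; have [i Si] : exists i, S i.
    apply/existsP; apply: contraNT S0; rewrite negb_exists => /forallP S0.
    by apply/eqP/ffunP => i; rewrite word0 (negPf (S0 i)).
  (* Flipping T at a letter of S changes the sign of the term. *)
  apply: add_self_eq0.
  rewrite {2}(reindex_inj (addIr (single i))) -big_split /= big1 // => T _.
  rewrite /f [ip S (_ + _)]ipC ipDl ip_single Si addbT addbN signrN ipC.
  exact: subrr.
have total : \sum_T \sum_(S | L S) f S T = #|{: word}|%:R.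
  rewrite exchange_big /= (bigD1 (0 : word)) //= sumT eqxx mul1r big1 ?addr0 //
    => S.
  by case/andP => _ /negPf S0; rewrite sumT S0 mul0r.
have /existsP[T fT] : [exists T, \sum_(S | L S) f S T != 0].
  apply: contraPT total; rewrite negb_exists => /forallP f0.
  rewrite big1 => [|T _]; last by have := f0 T; rewrite negbK => /eqP.
  move/eqP; rewrite eq_sym pnatr_eq0 => /eqP/card0_eq/(_ (0 : word)).
  by rewrite !inE.
exists T => S0 LS0; apply/eqP; apply: contraNT fT => neq.
(* Translating S by a word on which psi S and ip S T differ changes the sign. *)
apply/eqP/add_self_eq0; rewrite {2}(reindex_inj (addIr S0)) /=.
rewrite [X in _ + X](eq_bigl L) => [|S]; last first.
  apply/idP/idP => [/LD/(_ LS0)|/LD]; last exact.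
  by rewrite wordK.
rewrite -big_split big1 //= => S LS; rewrite /f psiD // ipDl addbACA.
by move: neq; case: (psi S0); case: (ip S0 T) => // _;
  rewrite /= addbT signrN subrr.
Qed.

End Code.

Lemma wtE (I : finType) (T : {ffun I -> bool}) : wt T = (\sum_i T i)%N.
Proof.
rewrite /wt -sum1_card big_mkcond /=; apply: eq_bigr => i _.
by rewrite inE; case: (T i).
Qed.

(** The inclusion of the dual code in L; the converse one is [code_ip] for
    doubly even codes. *)
Definition self_dual (I : finType) (L : pred {ffun I -> bool}) : Prop :=
  forall T, ~~ L T -> exists2 S, L S & ip S T.

(** * Construction of the codes *)

Section SumCode.
Variables (I1 I2 : finType).
Local Notation word := {ffun (I1 + I2)%type -> bool}.

Definition left_word (T : word) : {ffun I1 -> bool} := [ffun i => T (inl i)].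
Definition right_word (T : word) : {ffun I2 -> bool} := [ffun i => T (inr i)].
Definition join_word (T1 : {ffun I1 -> bool}) (T2 : {ffun I2 -> bool}) : word :=
  [ffun i => match i with inl j => T1 j | inr j => T2 j end].
Definition sum_code L1 L2 (T : word) : bool
    := L1 (left_word T) && L2 (right_word T).

Lemma left_join T1 T2 : left_word (join_word T1 T2) = T1.
Proof. by apply/ffunP => i; rewrite !ffunE. Qed.

Lemma right_join T1 T2 : right_word (join_word T1 T2) = T2.
Proof. by apply/ffunP => i; rewrite !ffunE. Qed.

Lemma left_wordD S T : left_word (S + T) = left_word S + left_word T.
Proof. by apply/ffunP => i; rewrite !ffunE. Qed.

Lemma right_wordD S T : right_word (S + T) = right_word S + right_word T.
Proof. by apply/ffunP => i; rewrite !ffunE. Qed.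

Lemma wt_sum T : wt T = (wt (left_word T) + wt (right_word T))%N.
Proof.
by rewrite !wtE big_sumType; congr (_ + _)%N; apply: eq_bigr => i _;
  rewrite ffunE.
Qed.

Lemma ip_join T1 T2 T :
  ip (join_word T1 T2) T = ip T1 (left_word T) (+) ip T2 (right_word T).
Proof.
rewrite /ip big_sumType; congr (_ (+) _);
  by apply: eq_bigr => i _; rewrite !ffunE.
Qed.

(** Self-duality of the second summand is what makes [code_max] survive: a
    word orthogonal to the sum code lies in L2 on the right, so its weight is
    that of its left part modulo 4. *)
Lemma good_code_sum e L1 L2 :
    good_code (fun i => e (inl i)) L1 -> good_code (fun i => e (inr i)) L2 ->
    self_dual L2 ->
  good_code e (sum_code L1 L2).
Proof.
move=> good1 good2 dual2.
have word0l : left_word 0 = 0 by apply/ffunP => i; rewrite !ffunE.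
have word0r : right_word 0 = 0 by apply/ffunP => i; rewrite !ffunE.
split.
- by rewrite /sum_code word0l word0r (code0 good1) (code0 good2).
- move=> S T /andP[S1 S2] /andP[T1 T2].
  by rewrite /sum_code left_wordD right_wordD (codeD good1) ?(codeD good2).
- move=> S /andP[S1 S2].
  by rewrite wt_sum dvdn_add ?(code_wt good1) ?(code_wt good2).
- move=> S /andP[/(code_even good1) S1 /(code_even good2) S2].
  rewrite big_sumType -[RHS]/(false (+) false) -{1}S1 -S2.
  by congr (_ (+) _); apply: eq_bigr => i _; rewrite ffunE.
move=> T; have [LT2 | /dual2[S LS ST] _] := boolP (L2 (right_word T));
  last first.
  by left; exists (join_word 0 S); rewrite ?ip_join ?ip0l // /sum_code
    left_join right_join (code0 good1).
rewrite /sum_code LT2 andbT => /(code_max good1)[[S LS ST]|oddT].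
  left; exists (join_word S 0); rewrite ?ip_join ?ip0l ?addbF //.
  by rewrite /sum_code left_join right_join LS (code0 good2).
right; rewrite wt_sum odd_uphalf; move: oddT; rewrite odd_uphalf.
have /dvdnP[m ->] := code_wt good2 LT2.
rewrite (_ : (m * 4 = (m * 2).*2)%N); last by rewrite -muln2 -mulnA.
by rewrite oddD odd_double addbF halfD odd_double andbF add0n oddD doubleK oddM
  andbF addbF.
Qed.

End SumCode.

Lemma big_pair (R : Type) (idx : R) (op : Monoid.com_law idx) (K I : finType)
    (F : K * I -> R) :
  \big[op/idx]_p F p = \big[op/idx]_j \big[op/idx]_i F (j, i).
Proof. by rewrite pair_bigA; apply: eq_bigr => -[]. Qed.

Section BlockCode.
Variables (K I : finType).
Local Notation word := {ffun (K * I)%type -> bool}.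

Definition block (T : word) (j : K) : {ffun I -> bool} := [ffun i => T (j, i)].
Definition one_block (j : K) (S : {ffun I -> bool}) : word :=
  [ffun k => (k.1 == j) && S k.2].
Definition block_code L (T : word) : bool := [forall j, L (block T j)].

Lemma blockD S T j : block (S + T) j = block S j + block T j.
Proof. by apply/ffunP => i; rewrite !ffunE. Qed.

Lemma block0 j : block 0 j = 0.
Proof. by apply/ffunP => i; rewrite !ffunE. Qed.

Lemma wt_block T : wt T = (\sum_j wt (block T j))%N.
Proof.
rewrite wtE big_pair.
by apply: eq_bigr => j _; rewrite wtE; apply: eq_bigr => i _; rewrite ffunE.
Qed.

Lemma self_dual_block (L : pred {ffun I -> bool})
    : L 0 -> self_dual L -> self_dual (block_code L).
Proof.
move=> L0 dualL T; rewrite negb_forall => /existsP[j /dualL[S LS ST]].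
exists (one_block j S).
  apply/forallP => j'; have [->|jj'] := eqVneq j' j.
    by rewrite (_ : block _ _ = S) //; apply/ffunP => i; rewrite !ffunE eqxx.
  by rewrite (_ : block _ _ = 0) //; apply/ffunP => i;
    rewrite !ffunE (negPf jj').
suff -> : ip (one_block j S) T = ip S (block T j) by [].
rewrite /ip big_pair.
rewrite (bigD1 j) //= [X in _ + X]big1 ?addr0 => [|j' /negPf jj']; last first.
  by apply: big1 => i _; rewrite ffunE /= jj'.
by apply: eq_bigr => i _; rewrite !ffunE eqxx.
Qed.

Lemma good_code_block e (L : pred {ffun I -> bool}) :
    (forall j, good_code (fun i => e (j, i)) L) -> L 0 -> self_dual L ->
  good_code e (block_code L).
Proof.
move=> goodL L0 dualL; split.
- by apply/forallP => j; rewrite block0.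
- move=> S T /forallP LS /forallP LT; apply/forallP => j; rewrite blockD.
  exact: (codeD (goodL j)).
- move=> S /forallP LS; rewrite wt_block; apply: dvdn_sum => j _.
  exact: (code_wt (goodL j)).
- move=> S /forallP LS.
  rewrite big_pair big1 // => j _.
  by rewrite -[RHS](code_even (goodL j) (LS j)); apply: eq_bigr => i _;
    rewrite ffunE.
by move=> T LT; left; apply: self_dual_block.
Qed.

End BlockCode.

(** The extended Hamming code of length 8, with a parity check matrix that is
    also a generator matrix, in coordinates where both halves of the 8
    letters are words of the code. *)
Definition hamming_check (c : 'I_4) : {ffun 'I_8 -> bool} :=
  [ffun k : 'I_8 => nth false (nth [::]
     [:: [:: true; true; true; true; false; false; false; false];
         [:: false; false; false; false; true; true; true; true];
         [:: true; true; false; false; true; true; false; false];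
         [:: true; false; true; false; true; false; true; false]] c) k].

Definition hamming (T : {ffun 'I_8 -> bool}) : bool :=
  [forall c, ~~ ip (hamming_check c) T].

Lemma self_dual_hamming : self_dual hamming.
Proof.
move=> T; rewrite negb_forall => /existsP[c]; rewrite negbK => cT.
exists (hamming_check c) => //; apply/forallP => d.
rewrite /ip !big_ord_recl big_ord0 !ffunE.
by case: c d {cT} => -[|[|[|[|//]]]] ? [[|[|[|[|//]]]] ?].
Qed.

(** The halves are codewords, so each word of the code meets each half
    evenly; hence the signature may differ on the two halves. *)
Lemma good_code_hamming (e : 'I_8 -> bool) :
    (forall k k' : 'I_8, (k < 4)%N = (k' < 4)%N -> e k = e k') ->
  good_code e hamming.
Proof.
move=> e_half; split.
- by apply/forallP => c; rewrite ipC ip0l.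
- move=> S T /forallP LS /forallP LT; apply/forallP => c.
  by rewrite ipC ipDl ![ip _ (hamming_check c)]ipC (negPf (LS c)) (negPf (LT
    c)).
- move=> S /forallP LS; move: (LS (inord 0)) (LS (inord 1)) (LS (inord 2)) (LS
    (inord 3)).
  rewrite wtE /ip !big_ord_recl !big_ord0 !ffunE !inordK //=.
  do 8!case: (S _) => //=.
- move=> S /forallP LS; move: (LS (inord 0)) (LS (inord 1)).
  rewrite /ip !big_ord_recl !big_ord0 !ffunE !inordK //=.
  have e0 (k : 'I_8) : e k = if (k < 4)%N then e ord0 else e ord_max.
    by case: ifP => k4; apply: e_half; rewrite k4.
  rewrite ![e (lift _ _)]e0 /=.
  by case: (e ord0); case: (e ord_max); do 8!case: (S _) => //=.
by move=> T LT; left; apply: self_dual_hamming.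
Qed.

(** The zero code, except for n = 4 where it is the repetition code. *)
Definition small_code (n : nat) (T : {ffun 'I_n -> bool}) : bool :=
  (wt T == 0%N) || (n == 4%N) && (wt T == 4%N).

(** For n = 1 and n = 2 every nonzero word has weight 1 or 2. For n = 4 the
    words of odd weight overlap the full word oddly, and those of even weight
    outside the code have weight 2. For n = 3 the full word would violate
    [code_max]. *)
Lemma good_code_small n :
  n \in [:: 0; 1; 2; 4]%N -> good_code (fun=> true) (@small_code n).
Proof.
have max_wt m (T : {ffun 'I_m -> bool}) : odd (wt T) -> ip [ffun=> true] T.
  suff -> : ip [ffun=> true] T = odd (wt T) by [].
  rewrite wtE /ip (big_morph odd oddD (erefl : odd 0 = false)).
  by apply: eq_bigr => i _; rewrite ffunE oddb.
move=> n_small; split.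
- by rewrite /small_code wt0.
- move: n_small; rewrite !inE => /or4P[] /eqP -> S T;
    rewrite /small_code !wtE ?big_ord_recl !big_ord0 ?wordD //=;
    by do ?[case: (S _); case: (T _) => //=].
- by move=> S /orP[/eqP-> | /andP[_ /eqP->]].
- move=> S; move: n_small; rewrite !inE => /or4P[] /eqP nE; move: S;
    rewrite nE => S;
    rewrite /small_code wtE ?big_ord_recl !big_ord0 //=;
    by do ?[case: (S _) => //=].
move=> T; move: n_small; rewrite !inE => /or4P[] /eqP nE; move: T;
  rewrite nE => T LT.
- by move: LT; rewrite /small_code wtE big_ord0.
- right; move: LT; rewrite /small_code wtE big_ord_recl big_ord0.
  by case: (T _).
- right; move: LT; rewrite /small_code wtE !big_ord_recl big_ord0.
  by do ?[case: (T _) => //=].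
have [oddT|evenT] := boolP (odd (wt T)).
  left; exists [ffun=> true]; last exact: max_wt.
  by rewrite /small_code wtE !big_ord_recl big_ord0 !ffunE.
right; move: LT evenT; rewrite /small_code wtE !big_ord_recl big_ord0.
by do ?[case: (T _) => //=].
Qed.

(** * Systems of Clifford generators *)

Section Form.
Variables (R : fieldType) (V : vectType R) (B : {symmetric V}).

Lemma symmC u v : B u v = B v u.
Proof. by rewrite hermitian_subproof expr0 mul1r. Qed.

Lemma nondegenerateP :
  reflect (forall u, (forall w, B u w = 0) -> u = 0) (nondegenerate B).
Proof.
apply: (iffP eqP) => [rad0 u Bu0 | Brad].
  apply/eqP; rewrite -memv0 -rad0; apply/mem_orthovP => w _.
  exact: Bu0.
apply/eqP; rewrite -subv0; apply/subvP => u /mem_orthovP Bu.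
by rewrite memv0; apply/eqP/Brad => w; apply/Bu/memvf.
Qed.

End Form.

Section Act.
Variables (I : finType) (R : fieldType) (V : vectType R).
Variable J : I -> 'End(V).
Local Notation word := {ffun I -> bool}.
Implicit Types (S T U : word) (i j : I) (s : seq I).

Definition act_seq s T : 'End(V) :=
  foldr (fun i f => if T i then J i \o f else f)%VF \1%VF s.
Definition act T : 'End(V) := act_seq (enum I) T.

Lemma act0 v : act 0 v = v.
Proof.
by rewrite /act; elim: (enum I) => [|i s IH] /=; rewrite ?word0 ?id_lfunE.
Qed.

End Act.

(** Moving J_i to its place in an ordered product costs one sign for each
    letter that precedes i. *)
Fixpoint preceding_parity (I : eqType) (s : seq I) (i : I)
    (T : I -> bool) : bool :=
  if s is j :: s' then
    if j == i then false else T j (+) preceding_parity s' i T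
  else false.

Definition pos_sign (I : finType) (i : I) (T : {ffun I -> bool}) : bool :=
  preceding_parity (enum I) i T.

(** The boolean e i is the exponent of the sign of J_i^2; it is true on the
    generators of positive square norm, where J_i^2 = -1. The index set is
    arbitrary so that it can carry the block structure of a code. *)
Record clifford_system (I : finType) (e : I -> bool) (R : fieldType)
    (V : vectType R) (B : {symmetric V}) (J : I -> 'End(V)) : Prop :=
  CliffordSystem {
    sys_sq : forall i v, J i (J i v) = (-1) ^+ e i *: v;
    sys_anti : forall i j v, i != j -> J i (J j v) = - J j (J i v);
    sys_skew : forall i v w, B (J i v) w = - B v (J i w) }.

Lemma scaler_swap (R : comNzRingType) (V : lmodType R) (a b : R) (v : V) :
  a *: (b *: v) = b *: (a *: v).
Proof. by rewrite !scalerA mulrC. Qed.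

Lemma lfunZ (R : comNzRingType) (U V : vectType R) (f : 'Hom(U, V)) (a : R)
    (v : U) :
  f (a *: v) = a *: f v.
Proof. exact: linearZ. Qed.

Section System.
Variables (I : finType) (e : I -> bool) (R : fieldType).
Variables (V : vectType R) (B : {symmetric V}) (J : I -> 'End(V)).
Hypothesis sysJ : clifford_system e B J.
Local Notation word := {ffun I -> bool}.
Implicit Types (S T U : word) (i j : I) (s : seq I) (v w : V).

(** The basic multiplication rule of the Clifford group. All other signs are
    derived from it by adding one letter at a time. *)
Lemma gen_act i T v :
  J i (act J T v)
  = (-1) ^+ (pos_sign i T (+) (T i && e i)) *: act J (T + single i) v.
Proof.
have act_ext s T' : {in s, T =1 T'} -> act_seq J s T v = act_seq J s T' v.
  elim: s => //= j s IH TT'; rewrite -TT' ?mem_head //.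
  have {}IH := IH (fun k ks => TT' k (mem_behead (ks : k \in behead (j :: s)))).
  by case: (T j); rewrite ?lfunE /= ?IH.
rewrite /act /pos_sign.
have : i \in enum I by rewrite mem_enum.
elim: (enum I) (enum_uniq I) => //= j s IHs /andP[js us]; rewrite inE.
rewrite wordD ffunE [j == i]eq_sym; have [-> _ | ij /= is_] := eqVneq i j.
  have E : act_seq J s T v = act_seq J s (T + single j) v.
    apply: act_ext => k ks; rewrite wordD ffunE (_ : k == j = false) ?addbF //.
    by apply: contraNF js => /eqP <-.
  by case: (T j); rewrite /= ?expr0 ?scale1r comp_lfunE -E // (sys_sq sysJ).
rewrite addbF; case: (T j); rewrite /= ?comp_lfunE ?IHs //.
rewrite (sys_anti sysJ) // IHs // lfunZ -scaleNr.
by rewrite addNb signrN.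
Qed.

Lemma act_add_single i T v :
  act J (T + single i) v = (-1) ^+ (pos_sign i T (+) (T i && e i)) *: J i (act
    J T v).
Proof. by rewrite gen_act scalerA -signr_addb addbb scale1r. Qed.

Lemma gen_act_comm i T v :
  J i (act J T v) = (-1) ^+ (T i (+) odd (wt T)) *: act J T (J i v).
Proof.
elim/word_ind: T => [|j T Tj IH]; first by rewrite !act0 word0 wt0 scale1r.
rewrite !act_add_single lfunZ [RHS]scaler_swap; congr (_ *: _).
rewrite wt_add_single // wordD ffunE /=.
case: (eqVneq i j) IH => [->|ij] IH.
  by rewrite IH lfunZ (negPf Tj) /= negbK.
rewrite (sys_anti sysJ) // IH lfunZ -scaleNr.
by rewrite addbF addbN signrN.
Qed.

Lemma act_comm S T v :
  act J S (act J T v)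
  = (-1) ^+ (ip S T (+) (odd (wt S) && odd (wt T))) *: act J T (act J S v).
Proof.
elim/word_ind: S => [|i S Si IH]; first by rewrite !act0 ip0l wt0 scale1r.
rewrite !act_add_single !lfunZ [RHS]scaler_swap; congr (_ *: _).
rewrite IH lfunZ (gen_act_comm i T) scalerA -signr_addb; congr ((-1) ^+ _ *: _).
rewrite ipDl ip_single wt_add_single //=.
by case: (ip S T); case: (T i); case: (odd _); case: (odd _).
Qed.

Lemma act_adj T v w :
  B (act J T v) w = (-1) ^+ odd (uphalf (wt T)) * B v (act J T w).
Proof.
elim/word_ind: T v w => [|i T Ti IH] v w; first by rewrite !act0 wt0 mul1r.
rewrite !act_add_single linearZl_LR linearZ /= mulrCA; congr (_ * _).
rewrite (sys_skew sysJ) IH gen_act_comm linearZ /=.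
rewrite mulrA -mulNr -signr_addb -signrN wt_add_single //=.
congr ((-1) ^+ _ * _); rewrite (negPf Ti) /=.
by rewrite odd_uphalf; do 2 case: (odd _).
Qed.

Lemma act_sq T v :
  act J T (act J T v)
  = (-1) ^+ (odd (wt T)./2 (+) \sum_i (T i && e i)) *: v.
Proof.
elim/word_ind: T v => [|i T Ti IH] v.
  by rewrite !act0 wt0 big1 ?scale1r // => i _; rewrite word0.
rewrite !act_add_single lfunZ lfunZ scalerA -signr_addb addbb scale1r.
have -> : act J T (J i (act J T v))
    = (-1) ^+ (T i (+) odd (wt T)) *: J i (act J T (act J T v)).
  by rewrite (gen_act_comm _ _ (act J T v)) scalerA -signr_addb addbb scale1r.
rewrite lfunZ (sys_sq sysJ) IH !scalerA -!signr_addb; congr ((-1) ^+ _ *: _).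
rewrite wt_add_single //= (negPf Ti) odd_uphalf.
have -> : \sum_j ((T + single i) j && e j) = (\sum_j (T j && e j)) (+) e i.
  rewrite (bigD1 i) // [in RHS](bigD1 i) //= wordD ffunE eqxx (negPf Ti) /=.
  rewrite add0r addbC; congr (_ (+) _); apply: eq_bigr => j /negPf ji.
  by rewrite wordD ffunE ji addbF.
move: (\sum_j (T j && e j) : bool) => x.
by case: x; case: (e i); do 2!case: (odd _).
Qed.

End System.

(** The sign k is quantified before the system: the sign cocycle depends on
    the signature e only through the squares of the common letters. This is
    what allows systems of opposite signatures to be compared. *)
Lemma act_comp (I : finType) (R : fieldType) (S : {ffun I -> bool}) :
  exists k : {ffun I -> bool} -> bool,
  forall (e : I -> bool) (V : vectType R) (B : {symmetric V})
    (J : I -> 'End(V)),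
  clifford_system e B J -> forall T v,
  act J S (act J T v)
  = (-1) ^+ (k T (+) \sum_i (S i && T i && e i)) *: act J (S + T) v.
Proof.
elim/word_ind: S => [|i S Si [k kP]].
  exists (fun=> false) => e V B J sysJ T v.
  by rewrite act0 add0r big1 ?scale1r // => i _; rewrite word0.
exists (fun T => pos_sign i S (+) k T (+) pos_sign i (S + T)) => e V B J sysJ T
  v.
rewrite (act_add_single sysJ) (kP _ _ _ _ sysJ) lfunZ (gen_act sysJ) !scalerA.
rewrite -!signr_addb addrAC; congr ((-1) ^+ _ *: _).
have -> : \sum_j ((S + single i) j && T j && e j)
    = (\sum_j (S j && T j && e j)) (+) (T i && e i).
  rewrite (bigD1 i) // [in RHS](bigD1 i) //= wordD ffunE eqxx (negPf Si) /=.
  rewrite add0r addbC; congr (_ (+) _); apply: eq_bigr => j /negPf ji.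
  by rewrite wordD ffunE ji addbF.
rewrite wordD (negPf Si) /=.
move: (\sum_j _ : bool) => x.
by case: x; case: (T i); case: (e i); case: (k T); case: pos_sign;
  case: pos_sign.
Qed.

(** * Common eigenvectors *)

Lemma lfunD (R : comNzRingType) (U V : vectType R) (f : 'Hom(U, V)) (u v : U) :
  f (u + v) = f u + f v.
Proof. exact: linearD. Qed.

Section Eigen.
Variables (I : finType) (R : rcfType) (V : vectType R) (B : {symmetric V}).
Variables (e : I -> bool) (L : pred {ffun I -> bool}) (J : I -> 'End(V)).
Local Notation word := {ffun I -> bool}.
Hypotheses (sysJ : clifford_system e B J) (goodL : good_code e L).

Definition eigenvector (chi : word -> bool) (v : V) : Prop :=
  forall S, L S -> act J S v = (-1) ^+ chi S *: v.

Lemma act_codeK S v : L S -> act J S (act J S v) = v.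
Proof.
by move=> LS; rewrite (act_sq sysJ) (code_odd_half goodL) // (code_even goodL)
  // scale1r.
Qed.

Lemma act_code_adj S v w : L S -> B (act J S v) w = B v (act J S w).
Proof. by move=> LS; rewrite (act_adj sysJ) (code_odd_uphalf goodL) // mul1r.
  Qed.

Lemma act_norm T v :
  exists b : bool, B (act J T v) (act J T v) = (-1) ^+ b * B v v.
Proof.
by rewrite (act_adj sysJ) (act_sq sysJ) linearZ /= mulrA -signr_addb; eexists.
Qed.

Lemma ex_nonisotropic :
  nondegenerate B -> (0 < \dim {:V})%N -> exists v, B v v != 0.
Proof.
move=> /nondegenerateP Bnd; rewrite lt0n dimv_eq0 => V0.
apply: contrapT => Biso; have {}Biso v : B v v = 0.
  by apply/eqP; apply/negPn/negP => ?; apply: Biso; exists v.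
suff V0' : (fullv : {vspace V}) = 0%VS by rewrite V0' eqxx in V0.
apply/eqP; rewrite -subv0; apply/subvP => u _; rewrite memv0; apply/eqP.
apply: Bnd => w; have := Biso (u + w).
rewrite linearDl !linearD /= !Biso (symmC B w u) add0r addr0.
by move/eqP; rewrite -mulr2n mulrn_eq0 => /eqP.
Qed.

(** The words of L are treated one after the other. Given a common
    eigenvector v of the previous involutions, v + J_S v and v - J_S v are
    eigenvectors of J_S as well, and they are not both isotropic, because J_S
    is an isometry and the sum of their square norms is 4 <v, v>. *)
Lemma ex_eigenvector :
    nondegenerate B -> (0 < \dim {:V})%N ->
  exists (chi : word -> bool) (v : V) (g : bool),
    eigenvector chi v /\ B v v = (-1) ^+ g.
Proof.
move=> Bnd V0.
have [v [v0 vE]] : exists v, B v v != 0 /\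
    forall S, S \in [seq S <- enum {: word} | L S] ->
      exists b : bool, act J S v = (-1) ^+ b *: v.
  have := filter_all L (enum {: word}).
  elim: [seq S <- _ | _] => [_|S l IH /= /andP[LS /[dup] /allP Ll /IH [v [v0
    vE]]]].
    by have [v v0] := ex_nonisotropic Bnd V0; exists v.
  have Sv : B (act J S v) (act J S v) = B v v by rewrite act_code_adj //
    act_codeK.
  pose w (b : bool) := v + (-1) ^+ b *: act J S v.
  have [b wb] : exists b, B (w b) (w b) != 0.
    apply: contrapT => wiso; have {}wiso b : B (w b) (w b) = 0.
      by apply/eqP; apply/negPn/negP => ?; apply: wiso; exists b.
    have := wiso false; have := wiso true; rewrite /w expr0 expr1 scale1r
      scaleN1r.
    rewrite !(linearDl, linearNl, linearD, linearN) /= Sv.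
    set x := B v (act J S v); set y := B (act J S v) v => h1 h2.
    case/eqP: v0; lra.
  exists (w b); split=> // T; rewrite inE => /orP[/eqP ->|Tl].
    exists b; rewrite /w lfunD lfunZ act_codeK // scalerDr scalerA -signr_addb.
    by rewrite addbb scale1r addrC.
  have LT := Ll _ Tl; have [c vT] := vE _ Tl; exists c.
  rewrite /w lfunD lfunZ (act_comm sysJ) (code_ip goodL) //.
  rewrite (code_odd goodL LT) /= scale1r vT lfunZ scaler_swap.
  by rewrite -scalerDr.
pose a : R := (Num.sqrt `|B v v|)^-1.
have a0 : 0 < a by rewrite invr_gt0 sqrtr_gt0 normr_gt0.
(* The sign of J_S on v is read off v itself: v <> - v in characteristic 0. *)
exists (fun S => act J S v != v), (a *: v), (B v v < 0); split.
  move=> S LS; have [|b vS] := vE S; first by rewrite mem_filter LS mem_enum.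
  have v_nz : v != 0 by apply: contraNneq v0 => ->; rewrite linear0l.
  rewrite lfunZ scaler_swap vS; congr (_ *: (_ *: _)).
  case: b {vS}; last by rewrite expr0 scale1r eqxx.
  rewrite expr1 scaleN1r eq_sym -subr_eq0 opprK -mulr2n -scaler_nat.
  by rewrite scaler_eq0 pnatr_eq0 (negPf v_nz).
rewrite linearZl_LR linearZ /= [X in a * (a * X)]numEsign !(mulrCA a).
rewrite -[RHS]mulr1; congr (_ * _).
have sqrt0 : Num.sqrt `|B v v| != 0 by rewrite gt_eqF // sqrtr_gt0 normr_gt0.
by rewrite -(@sqr_sqrtr _ `|B v v|) // expr2 /a mulKf ?mulVf.
Qed.

End Eigen.

(** With h = true this is the signature with positive and negative generators
    exchanged; the boolean lets both modules be treated by the same lemmas. *)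
Definition twist (I : Type) (h : bool) (e : I -> bool)
    (i : I) : bool := e i (+) h.

Lemma good_code_twist (I : finType) (e : I -> bool) L h :
  good_code e L -> good_code (twist h e) L.
Proof.
case: h => goodL; case: (goodL) => L0 LD L4 Le Lm; split=> // S LS; last first.
  by rewrite -[RHS](Le _ LS); apply: eq_bigr => i _; rewrite /twist addbF.
have -> : \sum_i (S i && twist true e i) = ip S S (+) \sum_i (S i && e i).
  rewrite /ip -[RHS]/((_ : bool) + _) -big_split /=.
  by apply: eq_bigr => i _; rewrite /twist; case: (S i); case: (e i).
by rewrite Le // (code_ip goodL).
Qed.

Section Matching.
Variables (I : finType) (R : rcfType) (e : I -> bool).
Variable L : pred {ffun I -> bool}.
Hypothesis goodL : good_code e L.
Variables (V V' : vectType R) (B : {symmetric V}) (B' : {symmetric V'}).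
Variables (J : I -> 'End(V)) (J' : I -> 'End(V')).
Hypotheses (sysJ : clifford_system (twist false e) B J).
Hypotheses (sysJ' : clifford_system (twist true e) B' J').
Local Notation word := {ffun I -> bool}.

(** Neither chi nor chi' need be additive, because of the cocycle of
    [act_comp]. The two cocycles differ by the parity of the overlap of S and
    T, which is even on L, so their quotient is additive. *)
Lemma eigenvalue_quotient chi chi' v v' :
    v != 0 -> v' != 0 -> eigenvector L J chi v -> eigenvector L J' chi' v' ->
  forall S T, L S -> L T ->
    chi (S + T) (+) chi' (S + T) = (chi S (+) chi' S) (+) (chi T (+) chi' T).
Proof.
move=> v0 v0' vE vE' S T LS LT; have [k kP] := act_comp R S.
have sgn_inj (W : vectType R) (w : W) (a b : bool) :
    w != 0 -> (-1) ^+ a *: w = (-1) ^+ b *: w -> a = b.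
  move=> w0 /eqP; rewrite -subr_eq0 -scalerBl scaler_eq0 (negPf w0) orbF
    subr_eq0.
  by move=> /eqP/signr_inj.
have [kc kc'] := (kP _ _ _ _ sysJ T v, kP _ _ _ _ sysJ' T v').
have LST := codeD goodL LS LT.
move: kc kc'; rewrite !vE ?vE' // !lfunZ !vE ?vE' // !scalerA -!signr_addb.
move=> /(sgn_inj _ _ _ _ v0) h /(sgn_inj _ _ _ _ v0') h'.
have : (\sum_i (S i && T i && twist false e i)) (+) (\sum_i (S i && T i &&
  twist true e i)) = false.
  rewrite -[RHS](code_ip goodL LS LT) -[LHS]/((_ : bool) + _) -big_split /=.
  by apply: eq_bigr => i _; rewrite /twist; case: (S i); case: (T i);
    case: (e i).
move: h h'; move: (\sum_i _ : bool) (\sum_i _ : bool) => x y.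
case: (chi S); case: (chi T); case: (chi' S); case: (chi' T); case: (k T);
  by case: x; case: y; case: (chi (S + T)); case: (chi' (S + T)).
Qed.

Lemma matched_eigenvectors :
    nondegenerate B -> (0 < \dim {:V})%N -> nondegenerate B' -> (0 < \dim
      {:V'})%N ->
  exists (chi : word -> bool) (v : V) (v' : V') (g g' : bool),
    [/\ eigenvector L J chi v, B v v = (-1) ^+ g,
        eigenvector L J' chi v' & B' v' v' = (-1) ^+ g'].
Proof.
move=> nB dV nB' dV'.
have [chi [v [g [vE vv]]]] := ex_eigenvector sysJ (good_code_twist _ goodL) nB
  dV.
have [chi' [v' [g' [vE' vv']]]] :=
  ex_eigenvector sysJ' (good_code_twist _ goodL) nB' dV'.
have v0 : v != 0.
  by apply/eqP => v0; move/eqP: vv; rewrite v0 linear0l eq_sym signr_eq0.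
have v0' : v' != 0.
  by apply/eqP => v0'; move/eqP: vv'; rewrite v0' linear0l eq_sym signr_eq0.
have [T TP] := character_ip (code0 goodL) (codeD goodL)
  (eigenvalue_quotient v0 v0' vE vE').
have [b bP] := act_norm sysJ' T v'.
exists chi, v, (act J' T v'), g, (b (+) g'); split=> //;
  last by rewrite bP vv' signr_addb.
move=> S LS; rewrite (act_comm sysJ') (code_odd goodL) //= addbF vE' // lfunZ
  scalerA.
by rewrite -signr_addb TP // -addbA addbb addbF.
Qed.

End Matching.

(** * Orbits of an eigenvector *)

(** What the extraction of an integral basis needs of the vectors J_T v. The
    signs s are a parameter since they differ for opposite signatures. *)
Record frame (I : finType) (R : fieldType) (V : vectType R) (B : {symmetric V})
    (J : I -> 'End(V)) (L : pred {ffun I -> bool})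
    (s : I -> {ffun I -> bool} -> bool) (x : {ffun I -> bool} -> V) : Prop :=
  Frame {
    frame_gen : forall i T, J i (x T) = (-1) ^+ s i T *: x (T + single i);
    frame_unit : exists g : bool, B (x 0) (x 0) = (-1) ^+ g;
    frame_stab : forall S, L S -> exists b : bool, x S = (-1) ^+ b *: x 0;
    frame_orth : forall T, ~~ L T -> B (x 0) (x T) = 0 }.

Section FrameConstruction.
Variables (I : finType) (R : rcfType) (e : I -> bool) (L : pred {ffun I ->
  bool}).
Hypothesis goodL : good_code e L.
Local Notation word := {ffun I -> bool}.

(** For h = true, J_i acts on the frame as D J_i does for h = false, D being
    the parity operator T |-> (-1)^(wt T); hence the extra sign - (-1)^(wt
    T). *)
Definition frame_sign (h : bool) (i : I) (T : word) : bool :=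
  pos_sign i T (+) (T i && e i) (+) (h && ~~ odd (wt T)).

(** For h = true, the rescaling (-1)^(t (t + 1) / 2), with t = wt T, accounts
    for moving the t copies of D in (D J_i1) ... (D J_it) to the right, D v =
    v. *)
Definition frame_vect (V : vectType R) (J : I -> 'End(V)) (v : V) (h : bool)
    (T : word) : V :=
  (-1) ^+ (h && odd (uphalf (wt T))) *: act J T v.

Lemma frame_vect0 (V : vectType R) (J : I -> 'End(V)) (v : V) h :
  frame_vect J v h 0 = v.
Proof. by rewrite /frame_vect wt0 andbF scale1r act0. Qed.

Lemma frame_vect_code (V : vectType R) (J : I -> 'End(V)) (v : V) h chi S :
  eigenvector L J chi v -> L S -> frame_vect J v h S = (-1) ^+ chi S *: v.
Proof.
by move=> vE LS; rewrite /frame_vect (code_odd_uphalf goodL) // andbF scale1r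
  vE.
Qed.

(** Either J_S v = +-v for a self-adjoint J_S that anticommutes with J_T, or
    J_T is skew; both make <v, J_T v> equal to its opposite. *)
Lemma eigenvector_orth (V : vectType R) (B : {symmetric V})
    (J : I -> 'End(V)) (h : bool) chi v T :
    clifford_system (twist h e) B J -> eigenvector L J chi v -> ~~ L T ->
  B v (act J T v) = 0.
Proof.
move=> sysJ vE /(code_max goodL).
have opp0 (y : R) : y = - y -> y = 0 by lra.
case=> [[S LS ST]|wT]; apply: opp0; last first.
  by rewrite {1}symmC (act_adj sysJ) wT mulN1r.
have goodL' := good_code_twist h goodL.
rewrite -{1}[act J T v](act_codeK sysJ goodL' _ LS) -(act_code_adj sysJ goodL'
  _ _ LS).
rewrite (act_comm sysJ) ST (code_odd goodL) //= vE // lfunZ scalerA.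
rewrite linearZl_LR linearZ /= expr1 mulN1r mulNr mulrN mulrA.
by rewrite -signr_addb addbb mul1r.
Qed.

Lemma frame_vectP (V : vectType R) (B : {symmetric V}) (J : I -> 'End(V))
    (h g : bool) chi v :
    clifford_system (twist h e) B J ->
    eigenvector L J chi v -> B v v = (-1) ^+ g ->
  frame B J L (frame_sign h) (frame_vect J v h).
Proof.
move=> sysJ vE vv; split.
- move=> i T; rewrite /frame_vect lfunZ (gen_act sysJ) !scalerA -!signr_addb.
  congr ((-1) ^+ _ *: _); rewrite /frame_sign /twist.
  case Ti : (T i) => /=; last first.
    rewrite wt_add_single ?Ti //= !addbF; case: h {sysJ} => /=;
      last by rewrite ?addbF.
    by rewrite odd_uphalf; case: (odd _); case: (odd _); case: (pos_sign i T).
  have Ti' : ~~ (T + single i) i by rewrite wordD Ti ffunE eqxx.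
  have -> : wt T = (wt (T + single i)).+1 by rewrite -(wt_add_single Ti') wordK.
  case: h {sysJ} => /=; last by rewrite ?addbF.
  by rewrite odd_uphalf; case: (odd _); case: (odd _); case: (pos_sign i T);
    case: (e i).
- by exists g; rewrite frame_vect0.
- by move=> S LS; exists (chi S); rewrite frame_vect0 (frame_vect_code h vE).
move=> T LT; rewrite frame_vect0 /frame_vect linearZ /=.
by rewrite (eigenvector_orth sysJ vE) ?mulr0.
Qed.

End FrameConstruction.

Section FrameTheory.
Variables (I : finType) (R : rcfType) (e0 e : I -> bool) (L : pred {ffun I ->
  bool}).
Hypothesis goodL : good_code e0 L.
Variables (V : vectType R) (B : {symmetric V}) (J : I -> 'End(V)).
Hypothesis sysJ : clifford_system e B J.
Local Notation word := {ffun I -> bool}.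
Variables (s : I -> word -> bool) (x : word -> V).
Hypothesis xF : frame B J L s x.

Lemma frame_add_single T i : x (T + single i) = (-1) ^+ s i T *: J i (x T).
Proof. by rewrite (frame_gen xF) scalerA -signr_addb addbb scale1r. Qed.

Lemma frame_form_step i T U :
  B (x (T + single i)) (x U) = (-1) ^+ (~~ (s i T (+) s i U)) * B (x T) (x (U +
    single i)).
Proof.
rewrite frame_add_single linearZl_LR /= (sys_skew sysJ) (frame_gen xF) linearZ
  /=.
by rewrite mulrN mulrA -signr_addb signrN mulNr.
Qed.

Lemma frame_form_shift T U :
  exists b : bool, B (x T) (x U) = (-1) ^+ b * B (x 0) (x (T + U)).
Proof.
elim/word_ind: T U => [|i T _ IH] U; first by exists false; rewrite add0r mul1r.
have [b bP] := IH (U + single i).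
rewrite frame_form_step bP mulrA -signr_addb addrA addrAC; by eexists.
Qed.

Lemma frame_stabD T S : L S -> exists b : bool, x (T + S) = (-1) ^+ b *: x T.
Proof.
move=> LS; elim/word_ind: T => [|i T _ [b bP]].
  by have [b bP] := frame_stab xF LS; exists b; rewrite add0r.
exists (s i (T + S) (+) b (+) s i T).
by rewrite addrAC !frame_add_single bP lfunZ !scalerA -!signr_addb -addbA addbb
  addbF.
Qed.

Lemma frame_orthD T U : ~~ L (T + U) -> B (x T) (x U) = 0.
Proof.
by move=> LTU; have [b ->] := frame_form_shift T U;
  rewrite (frame_orth xF) ?mulr0.
Qed.

Lemma frame_unitD T U : L (T + U) -> exists b : bool, B (x T) (x U) = (-1) ^+ b.
Proof.
move=> LTU; have [b ->] := frame_form_shift T U; have [g gP] := frame_unit xF.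
have [c ->] := frame_stab xF LTU.
by rewrite linearZ /= gP -!signr_addb; eexists.
Qed.

End FrameTheory.

(** With x = J_T v and x' the rescaled vectors J'_T v', the Gram matrices
    differ by (-1)^(wt T), as in the passage from <x, y> to <D x, y>; the
    factor of the twisted action of J'_i then cancels this sign, since T and
    T + i have opposite parities. *)
Lemma frame_compare (I : finType) (R : rcfType) (e : I -> bool)
    (L : pred {ffun I -> bool})
    (goodL : good_code e L)
    (V V' : vectType R) (B : {symmetric V}) (B' : {symmetric V'})
    (J : I -> 'End(V)) (J' : I -> 'End(V'))
    (chi : {ffun I -> bool} -> bool) (v : V) (v' : V') (g g' : bool)
    (x := frame_vect J v false) (x' := frame_vect J' v' true) :
    clifford_system (twist false e) B J -> clifford_system (twist true e) B' J'
      ->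
    eigenvector L J chi v -> B v v = (-1) ^+ g ->
    eigenvector L J' chi v' -> B' v' v' = (-1) ^+ g' ->
  forall i T U, B' (J' i (x' T)) (x' U) = (-1) ^+ (g (+) g') * B (J i (x T)) (x
    U).
Proof.
move=> sysJ sysJ' vE vv vE' vv' i T U.
have xF : frame B J L (frame_sign e false) x := frame_vectP goodL sysJ vE vv.
have xF' : frame B' J' L (frame_sign e true) x' := frame_vectP goodL sysJ' vE'
  vv'.
have xS S (LS : L S) : x S = (-1) ^+ chi S *: v := frame_vect_code goodL _ vE
  LS.
have xS' S (LS : L S) : x' S = (-1) ^+ chi S *: v' := frame_vect_code goodL _
  vE' LS.
have [x0 x0'] : x 0 = v /\ x' 0 = v' by split; apply: frame_vect0.
clearbody x x'.
have s_twist k S : frame_sign e true k S = frame_sign e false k S (+) ~~ odd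
  (wt S).
  by rewrite /frame_sign /= addbF.
have wt1 S k : odd (wt (S + single k)) = ~~ odd (wt S).
  rewrite odd_wtD -[single k]add0r wt_add_single ?wt0 ?word0 //=.
  exact: addbT.
have gram S W : B' (x' S) (x' W) = (-1) ^+ (g (+) g' (+) odd (wt S)) * B (x S)
  (x W).
  elim/word_ind: S W => [|k S _ IH] W.
    have [LW|LW] := boolP (L W); last first.
      by rewrite (frame_orth xF) // (frame_orth xF') // mulr0.
    rewrite x0 x0' xS // xS' // !linearZ /= vv vv' wt0 addbF -!signr_addb.
    by congr ((-1) ^+ _); case: (g); case: (g'); case: (chi W).
  have [LSW|LSW] := boolP (L (S + single k + W)); last first.
    by rewrite (frame_orthD sysJ xF) // (frame_orthD sysJ' xF') // mulr0.
  rewrite (frame_form_step sysJ xF) (frame_form_step sysJ' xF') IH !mulrA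
    -!signr_addb.
  congr ((-1) ^+ _ * _); rewrite !s_twist wt1.
  have := code_odd goodL LSW; rewrite odd_wtD wt1.
  by case: (odd _); case: (odd _); case: frame_sign; case: frame_sign;
    case: (g); case: (g').
rewrite (frame_gen xF) (frame_gen xF') !linearZl_LR /= gram !mulrA -!signr_addb.
congr ((-1) ^+ _ * _); rewrite s_twist wt1.
by case: (odd _); case: frame_sign; case: (g); case: (g').
Qed.

(** * Minimal modules are spanned by a frame *)

Section Submodule.
Variables (R : realType) (p q : nat) (M : admissible_module R p q).
Variable U : {vspace M}.

Definition restr_form (u w : subvs_of U) : R := am_form M (vsval u) (vsval w).

Fact restr_form_bilinear :
  bilinear_for (GRing.Scale.Law.clone _ _ ( *%R ) _)
    (GRing.Scale.Law.clone _ _ (idfun \; *%R ) _) restr_form.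
Proof.
split=> w a u v; rewrite /restr_form (linearP (@vsval _ _ U)) /=.
  by rewrite linearPl.
by rewrite linearD linearZ.
Qed.

HB.instance Definition _ :=
  bilinear_isBilinear.Build R _ _ _ _ _ restr_form restr_form_bilinear.
Fact restr_form_herm u w : restr_form u w = (-1) ^+ false * idfun (restr_form w
  u).
Proof. by rewrite /restr_form hermitian_subproof. Qed.
HB.instance Definition _ :=
  isHermitianSesquilinear.Build R _ false idfun restr_form restr_form_herm.

Definition restr_gen (Z : 'rV[R]_(p + q)) : 'End(subvs_of U) :=
  (linfun (vsproj U) \o am_rep M (cl_vect Z) \o linfun vsval)%VF.

Fact restr_gen_linear : linear restr_gen.
Proof.
move=> a Z W.
rewrite /restr_gen !linearP comp_lfunDr comp_lfunDl.
by rewrite -comp_lfunZr -comp_lfunZl.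
Qed.
HB.instance Definition _ := GRing.isLinear.Build R _ _ _ restr_gen
  restr_gen_linear.

Hypothesis U_gt0 : (0 < \dim U)%N.
Hypothesis U_stable : forall Z u, u \in U -> am_rep M (cl_vect Z) u \in U.
Hypothesis U_nondeg :
  forall u, u \in U -> (forall w, w \in U -> am_form M u w = 0) -> u = 0.

Lemma restr_genE Z u : vsval (restr_gen Z u) = am_rep M (cl_vect Z) (vsval u).
Proof. by rewrite /restr_gen !comp_lfunE !lfunE /= vsprojK ?U_stable ?subvsP.
  Qed.

Lemma generator_sq Z (v : M) : am_rep M (cl_vect Z)
    (am_rep M (cl_vect Z) v) = - pdot Z Z *: v.
Proof.
have /lfunP/(_ v) := congr1 (am_rep M) (cl_vect_square Z).
by rewrite cl_repM linearZ /= cl_rep1 !lfunE /= lfunE.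
Qed.

(** A stable nondegenerate subspace is admissible for the restricted action
    and form; hence a minimal module has no proper one. *)
Lemma submodule_admissible :
  exists M' : admissible_module R p q, \dim {:M'} = \dim U.
Proof.
have [J JE] : exists J : cl_representation p q (subvs_of U),
    forall Z, J (cl_vect Z) = restr_gen Z.
  apply: cl_representation_extend => Z; apply/lfunP=> u; apply/val_inj.
  by rewrite lfunE /= !restr_genE generator_sq !lfunE /= lfunE.
have dimU : \dim {: subvs_of U} = \dim U by rewrite dimvf.
have nd : nondegenerate restr_form.
  apply/nondegenerateP => u Bu; apply/val_inj/U_nondeg => [|w wU];
    first exact: subvsP.
  by rewrite -(vsprojK wU); apply: Bu.
have sk Z v w : restr_form (J (cl_vect Z) v) w = - restr_form v (J (cl_vect Z)
  w).
  by rewrite /restr_form JE !restr_genE am_skew.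
have U0 : (0 < \dim {: subvs_of U})%N by rewrite dimU.
by exists (AdmissibleModule U0 nd sk).
Qed.

Lemma minimal_submodule : minimal_admissible M -> U = fullv.
Proof.
case=> M_min _; have [M' dimM'] := submodule_admissible.
by apply/eqP; rewrite eqEdim subvf -dimM' M_min.
Qed.

End Submodule.

Section Cosets.
Variables (I : finType) (e : I -> bool) (L : pred {ffun I -> bool}).
Hypothesis goodL : good_code e L.
Local Notation word := {ffun I -> bool}.
Implicit Types S T U : word.

Definition coset_rep T : word := odflt T [pick U | L (T + U)].

Lemma coset_repP T : L (T + coset_rep T).
Proof.
rewrite /coset_rep; case: pickP => //= /(_ T).
by rewrite wordDD (code0 goodL).
Qed.

Lemma eq_coset_rep T U : L (T + U) -> coset_rep T = coset_rep U.
Proof.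
move=> LTU; have TU : (fun W => L (T + W)) =1 (fun W => L (U + W)).
  move=> W; apply/idP/idP => [LW|LW]; have := codeD goodL LTU LW.
    by rewrite addrACA wordDD add0r.
  by rewrite [T + U]addrC addrACA wordDD add0r addrC [W + _]addrC.
rewrite /coset_rep (eq_pick TU); case: pickP => //= /(_ U).
by rewrite wordDD (code0 goodL).
Qed.

Definition coset_count : nat := #|[set coset_rep T | T : word]|.

Definition transversal (a : 'I_coset_count) : word := enum_val a.

Lemma transversal_ex T : exists a, L (transversal a + T).
Proof.
have repT : coset_rep T \in [set coset_rep T | T : word] by apply: imset_f.
exists (enum_rank_in repT (coset_rep T)); rewrite /transversal enum_rankK_in //.
by rewrite addrC coset_repP.
Qed.

Lemma transversal_eq a c : L (transversal a + transversal c) -> a = c.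
Proof.
move=> /eq_coset_rep rep_ac; apply: enum_val_inj.
have fix_rep b : coset_rep (transversal b) = transversal b.
  rewrite /transversal; have /imsetP[T _ ->] := enum_valP b.
  by rewrite -(eq_coset_rep (coset_repP T)).
by rewrite -[LHS]fix_rep -[RHS]fix_rep.
Qed.

(** Otherwise i + j would be a word of weight 2 in the code. This is why a
    bracket of basis vectors involves at most one central generator. *)
Lemma code_pair_eq i j T : L (T + single i) -> L (T + single j) -> i = j.
Proof.
move=> Li Lj; apply/eqP; apply/negPn/negP => ij.
have := code_wt goodL (codeD goodL Li Lj); rewrite addrACA wordDD add0r.
rewrite wt_add_single; last by rewrite ffunE eq_sym.
by rewrite -[single i]add0r wt_add_single ?wt0 ?word0.
Qed.

End Cosets.

Lemma coord_span_tnth (R : fieldType) (V : vectType R) m (X : m.-tuple V) u :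
  u \in <<X>>%VS -> u = \sum_i coord X i u *: tnth X i.
Proof. by move/coord_span => {1}->; under eq_bigr do rewrite -tnth_nth. Qed.

Section FrameBasis.
Variables (I : finType) (R : rcfType) (e0 e : I -> bool) (L : pred {ffun I ->
  bool}).
Hypothesis goodL : good_code e0 L.
Variables (V : vectType R) (B : {symmetric V}) (J : I -> 'End(V)).
Hypothesis sysJ : clifford_system e B J.
Local Notation word := {ffun I -> bool}.
Variables (s : I -> word -> bool) (x : word -> V).
Hypothesis xF : frame B J L s x.

Definition frame_basis : (coset_count L).-tuple V :=
  [tuple x (transversal a) | a < coset_count L].

Lemma frame_basis_orth a c : a != c ->
  B (tnth frame_basis a) (tnth frame_basis c) = 0.
Proof.
move=> ac; rewrite !tnth_mktuple (frame_orthD sysJ xF) //.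
by apply: contra ac => /(transversal_eq goodL) ->.
Qed.

Lemma frame_basis_unit a :
  exists b : bool, B (tnth frame_basis a) (tnth frame_basis a) = (-1) ^+ b.
Proof.
rewrite tnth_mktuple; apply: (frame_unitD sysJ xF).
by rewrite wordDD (code0 goodL).
Qed.

Lemma form_frame_basis (k : 'I_(coset_count L) -> R) c :
  B (\sum_a k a *: tnth frame_basis a) (tnth frame_basis c)
  = k c * B (tnth frame_basis c) (tnth frame_basis c).
Proof.
rewrite linear_sumlz (bigD1 c) // big1 => [|a ac].
  by rewrite [LHS]addr0 linearZl_LR.
by rewrite linearZl_LR /= frame_basis_orth ?mulr0.
Qed.

Lemma frame_basis_free : free frame_basis.
Proof.
apply/freeP => k; under eq_bigr do rewrite -tnth_nth; move=> k0 c.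
have := form_frame_basis k c; rewrite k0 linear0l.
have [b ->] := frame_basis_unit c => /esym/eqP.
by rewrite mulf_eq0 signr_eq0 orbF => /eqP.
Qed.

Lemma frame_basis_mem T : x T \in <<frame_basis>>%VS.
Proof.
have [a La] := transversal_ex goodL T.
have [b] := frame_stabD xF (transversal a) La.
rewrite addrA wordDD add0r => ->; apply/memvZ/memv_span.
by rewrite -(tnth_mktuple (fun a => x (transversal a))) mem_tnth.
Qed.

Lemma frame_basis_stable i u :
  u \in <<frame_basis>>%VS -> J i u \in <<frame_basis>>%VS.
Proof.
move=> /coord_span_tnth ->; rewrite linear_sum; apply: memv_suml => a _.
rewrite linearZ /=; apply: memvZ; rewrite tnth_mktuple (frame_gen xF).
exact/memvZ/frame_basis_mem.
Qed.

Lemma frame_basis_nondegenerate u :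
  u \in <<frame_basis>>%VS ->
  (forall w, w \in <<frame_basis>>%VS -> B u w = 0) -> u = 0.
Proof.
move=> uX Bu; rewrite (coord_span_tnth uX) big1 // => c _.
have := Bu _ (memv_span (mem_tnth c frame_basis)).
rewrite {1}(coord_span_tnth uX) form_frame_basis.
have [b ->] := frame_basis_unit c => /eqP.
by rewrite mulf_eq0 signr_eq0 orbF => /eqP ->; rewrite scale0r.
Qed.

Lemma frame_basis_dim_gt0 : (0 < \dim <<frame_basis>>)%N.
Proof.
rewrite (eqnP frame_basis_free) size_tuple.
by apply/card_gt0P; exists (coset_rep L 0); apply: imset_f.
Qed.

End FrameBasis.

Section Module.
Variables (R : realType) (p q : nat) (M : admissible_module R p q).
Variables (I : finType) (sg : I -> 'I_(p + q)).
Hypothesis sg_bij : bijective sg.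

Definition generator (i : I) : 'End(M)
    := am_rep M (cl_vect (delta_mx 0 (sg i))).

Lemma row_sum_sg (Z : 'rV[R]_(p + q))
    : Z = \sum_i Z 0 (sg i) *: delta_mx 0 (sg i).
Proof. by rewrite [LHS]row_sum_delta (reindex sg) //; apply: onW_bij. Qed.

Lemma am_rep_sg Z (v : M) :
  am_rep M (cl_vect Z) v = \sum_i Z 0 (sg i) *: generator i v.
Proof.
rewrite {1}(row_sum_sg Z) !linear_sum sum_lfunE; apply: eq_bigr => i _.
by rewrite !linearZ /= scale_lfunE.
Qed.

(** Anticommutation comes from polarizing Z^2 = - <Z, Z> on a sum of two
    standard basis vectors. *)
Lemma generator_system :
  clifford_system (fun i => (sg i < p)%N) (am_form M) generator.
Proof.
have sqE i (v : M) : generator i (generator i v) = (-1) ^+ (sg i < p)%N *: v.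
  rewrite generator_sq pdot_delta mxE !eqxx mulr1 leqNgt.
  by case: (_ < _)%N; rewrite /= ?expr0 ?expr1 ?opprK.
split=> // [i j v ij|i v w]; last exact: am_skew.
have sg_neq : (sg i == sg j) = false.
  by rewrite (inj_eq (bij_inj sg_bij)) (negPf ij).
pose W : 'rV[R]_(p + q) := delta_mx 0 (sg i) + delta_mx 0 (sg j).
have Wi : W 0 (sg i) = 1 by rewrite !mxE !eqxx sg_neq addr0.
have Wj : W 0 (sg j) = 1 by rewrite !mxE !eqxx eq_sym sg_neq add0r.
have sgnE (k : 'I_(p + q)) : - (-1) ^+ (p <= k)%N = (-1) ^+ (k < p)%N :> R.
  by rewrite ltnNge -signrN.
have := generator_sq W v.
rewrite {3}/W pdotDl !pdot_delta Wi Wj !mulr1 opprD !sgnE scalerDl -!sqE.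
rewrite /W !linearD /= !add_lfunE !linearD /= -!/(generator _).
suff aux (a b c d : M) : a + b + (c + d) = a + d -> b = - c by move/aux.
rewrite addrA => /addIr; rewrite -addrA -[X in _ = X]addr0 => /addrI /eqP.
by rewrite addr_eq0 => /eqP.
Qed.

Lemma brackE (v w : M) :
  brack v w = \sum_i ((-1) ^+ (p <= sg i)%N * am_form M (generator i v) w)
                      *: delta_mx 0 (sg i).
Proof. by rewrite [LHS]row_sum_sg; apply: eq_bigr => i _; rewrite mxE. Qed.

Lemma minimal_frame_basis (e0 : I -> bool) L (goodL : good_code e0 L) s x :
    frame (am_form M) generator L s x -> minimal_admissible M ->
  basis_of fullv (frame_basis L x).
Proof.
move=> xF M_min; rewrite /basis_of (frame_basis_free goodL generator_system xF).
rewrite andbT; apply/eqP; apply: minimal_submodule M_min.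
- exact: (frame_basis_dim_gt0 goodL generator_system xF).
- move=> Z u uX; rewrite am_rep_sg; apply: memv_suml => i _; apply: memvZ.
  exact: (frame_basis_stable goodL xF _ uX).
exact: (frame_basis_nondegenerate goodL generator_system xF).
Qed.

(** * The integral basis *)

Section IntegralBasis.
Variables (e0 : I -> bool) (L : pred {ffun I -> bool}).
Hypothesis goodL : good_code e0 L.
Variables (s : I -> {ffun I -> bool} -> bool) (x : {ffun I -> bool} -> M).
Hypothesis xF : frame (am_form M) generator L s x.
Hypothesis M_min : minimal_admissible M.

Fact in_v_linear : linear (@in_v R p q M).
Proof.
by move=> a u v; rewrite -[RHS]/(a *: u + v, a *: 0 + 0) scaler0 addr0.
Qed.
HB.instance Definition _ := GRing.isLinear.Build R M (pseudoH M) _ (@in_v R p q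
  M)
  in_v_linear.

Fact in_z_linear : linear (@in_z R p q M).
Proof.
by move=> a u v; rewrite -[RHS]/(a *: 0 + 0, a *: u + v) scaler0 addr0.
Qed.
HB.instance Definition _ := GRing.isLinear.Build R _ (pseudoH M) _ (@in_z R p q
  M)
  in_z_linear.

(** The sign b is free: the comparison of two modules fixes it. *)
Definition center_basis (b : bool) : #|I|.-tuple 'rV[R]_(p + q) :=
  [tuple (-1) ^+ b *: delta_mx 0 (sg (enum_val k)) | k < #|I|].

Lemma center_basisP b : basis_of fullv (center_basis b).
Proof.
have card_I : #|I| = (p + q)%N by rewrite (bij_eq_card sg_bij) card_ord.
rewrite basisEdim size_tuple dimvf dim_matrix mul1r [X in (X <= _)%N]card_I
  leqnn andbT.
apply/subvP => Z _; rewrite (row_sum_sg Z).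
apply: memv_suml => i _; apply: memvZ.
have -> : delta_mx 0 (sg i) = (-1) ^+ b *: tnth (center_basis b) (enum_rank i).
  by rewrite tnth_mktuple enum_rankK scalerA -signr_addb addbb scale1r.
exact/memvZ/memv_span/mem_tnth.
Qed.

Lemma form_generator_zero i T U
    : ~~ L (T + U + single i) -> am_form M (generator i (x T)) (x U) = 0.
Proof.
move=> LTU; rewrite (frame_gen xF) linearZl_LR /=.
by rewrite (frame_orthD generator_system xF) ?mulr0 // addrAC.
Qed.

Lemma form_generator_unit i T U : L (T + U + single i) ->
  exists b : bool, am_form M (generator i (x T)) (x U) = (-1) ^+ b.
Proof.
move=> LTU; rewrite (frame_gen xF) linearZl_LR /=.
have [|b ->] := frame_unitD generator_system xF (T := T + single i) (U := U).
  by rewrite addrAC.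
by rewrite -signr_addb; eexists.
Qed.

Lemma brack_frame_zero T U : (forall i, ~~ L (T + U + single i)) -> brack (x T)
  (x U) = 0.
Proof.
move=> LTU; rewrite brackE big1 // => i _.
by rewrite form_generator_zero // mulr0 scale0r.
Qed.

Lemma brack_frame_unit i T U : L (T + U + single i) ->
  exists b : bool, brack (x T) (x U) = (-1) ^+ b *: delta_mx 0 (sg i).
Proof.
move=> LTU; have [b bP] := form_generator_unit LTU.
exists ((p <= sg i)%N (+) b).
rewrite brackE (bigD1 i) //= big1 ?addr0 ?bP ?signr_addb // => j ji.
rewrite form_generator_zero ?mulr0 ?scale0r //.
by apply: contra ji => LTUj; rewrite (code_pair_eq goodL LTU LTUj).
Qed.

(** The coset of T + k contains exactly one element of the transversal: this
    is the unique c required by the last condition. *)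
Lemma frame_integral_basis b : integral_basis (frame_basis L x)
    (center_basis b).
Proof.
have delta_neq0 k : delta_mx 0 k != 0 :> 'rV[R]_(p + q).
  by apply/eqP => /rowP/(_ k)/eqP; rewrite !mxE !eqxx oner_eq0.
have pm_delta (c d : bool) (i j : I) :
    is_pm (in_z M ((-1) ^+ c *: delta_mx 0 (sg i))) (in_z M ((-1) ^+ d *:
      delta_mx 0 (sg j)))
    <-> i = j.
  split=> [|->]; last first.
    have [<-|] := eqVneq c d; first by left.
    move=> cd; right; congr pair; rewrite ?oppr0 // -scaleNr -signrN.
    by move: cd; case: c; case: d.
  move=> H; apply/eqP/negPn/negP => ij.
  have {H} : ((-1) ^+ c *: delta_mx 0 (sg i) : 'rV[R]_(p + q)) 0 (sg i) = 0.
    have sgij : (sg i == sg j) = false by rewrite (inj_eq (bij_inj sg_bij))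
      (negPf ij).
    by case: H => /(congr1 (fun y : pseudoH M => y.2 0 (sg i)));
      rewrite /= !mxE sgij /= mulr0 ?oppr0.
  by rewrite !mxE !eqxx mulr1 => /eqP; rewrite signr_eq0.
have Xbasis := minimal_frame_basis goodL xF M_min.
split.
- rewrite basisEdim; apply/andP; split.
    apply/subvP => -[u z] _; rewrite span_cat.
    have -> : (u, z) = in_v u + in_z M z by congr pair; rewrite ?addr0 ?add0r.
    have Xu : u \in <<frame_basis L x>>%VS by rewrite (span_basis Xbasis) memvf.
    have Zz : z \in <<center_basis b>>%VS by rewrite (span_basis (center_basisP
      b)) memvf.
    rewrite (coord_span_tnth Xu) (coord_span_tnth Zz) !linear_sum.
    apply: memv_add; apply: memv_suml => k _; rewrite linearZ /=;
      exact/memvZ/memv_span/map_f/mem_tnth.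
  rewrite size_cat !size_map -!enumT !size_enum_ord -(size_basis Xbasis)
    -(size_basis (center_basisP b)).
  by rewrite !dimvf.
- rewrite pairwise_cat; apply/and3P; split.
  + apply/allrelP => _ _ /mapP[u _ ->] /mapP[z _ ->].
    by rewrite /pseudoH_form /= linear0r add0r -(scale0r z) pdotZl mul0r.
  + rewrite !pairwise_map -?enumT; have := enum_uniq 'I_(coset_count L);
      rewrite uniq_pairwise.
    apply: sub_pairwise => a c /= ac; apply/eqP.
    rewrite /pseudoH_form /= -(scale0r (0 : 'rV_(p + q))) pdotZl mul0r addr0.
    have := frame_basis_orth goodL generator_system xF ac.
    by rewrite !tnth_mktuple.
  rewrite !pairwise_map -?enumT; have := enum_uniq 'I_#|I|;
    rewrite uniq_pairwise.
  apply: sub_pairwise => k l /= kl; apply/eqP.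
  rewrite /pseudoH_form /= linear0l add0r pdotZl pdot_delta !mxE eqxx.
  by rewrite (inj_eq (bij_inj sg_bij)) (inj_eq enum_val_inj) (negPf kl) !mulr0.
- have sgn1 (c : bool) : (-1) ^+ c = 1 :> R \/ (-1) ^+ c = -1 :> R.
    by case: c; [right | left].
  move=> w; rewrite mem_cat => /orP[] /mapP[y /tnthP[k ->] ->];
    rewrite /pseudoH_form /=.
    rewrite -(scale0r (0 : 'rV_(p + q))) pdotZl mul0r addr0.
    by have [c ->] := frame_basis_unit goodL generator_system xF k.
  rewrite linear0l add0r tnth_mktuple pdotZl pdot_delta !mxE !eqxx mulr1 mulrCA.
  by rewrite -signr_addb addbb mulr1.
- move=> a c /=; rewrite !tnth_mktuple /lie /=.
  have [/existsP[i Li]|] := boolP [exists i, L (transversal a + transversal c +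
    single i)].
    right; exists (enum_rank i); have [d ->] := brack_frame_unit Li.
    by rewrite tnth_mktuple enum_rankK; apply/pm_delta.
  rewrite negb_exists => /forallP nL; left.
  by rewrite brack_frame_zero.
move=> k a.
have pmE c : is_pm (lie (in_v (tnth (frame_basis L x) a)) (in_v (tnth
  (frame_basis L x) c)))
       (in_z M (tnth (center_basis b) k))
    <-> L (transversal a + transversal c + single (enum_val k)).
  rewrite !tnth_mktuple /lie /=; split=> [|Lk]; last first.
    by have [d ->] := brack_frame_unit Lk; apply/pm_delta.
  have [/existsP[i Li]|] := boolP [exists i, L (transversal a + transversal c +
    single i)].
    by have [d ->] := brack_frame_unit Li; move/pm_delta => <-.
  rewrite negb_exists => /forallP nL; rewrite brack_frame_zero // => H; exfalso.
  have : (-1) ^+ b *: delta_mx 0 (sg (enum_val k)) = 0 :> 'rV[R]_(p + q).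
    by case: H => /(congr1 snd) /= /esym // /eqP; rewrite oppr_eq0 => /eqP.
  by move/eqP; rewrite scaler_eq0 signr_eq0 (negPf (delta_neq0 _)).
have [c Lc] := transversal_ex goodL (transversal a + single (enum_val k)).
exists c; split=> [|d /pmE Ld]; first by apply/pmE; rewrite addrAC addrC.
apply: (transversal_eq goodL); have := codeD goodL Lc Ld.
by rewrite (addrC (transversal a) (transversal d)) -(addrA (transversal d))
  addrACA wordDD addr0.
Qed.

End IntegralBasis.
End Module.

(** * Comparison of opposite signatures *)

Lemma clifford_system_ext (I : finType) (e e' : I -> bool) (R : fieldType)
    (V : vectType R) (B : {symmetric V}) (J : I -> 'End(V)) :
  e =1 e' -> clifford_system e B J -> clifford_system e' B J.
Proof. by move=> ee' [sq anti skew]; split=> // i v; rewrite -ee'. Qed.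

Lemma basis_isomorphism (R : fieldType) (V V' : vectType R) m
    (X : m.-tuple V) (X' : m.-tuple V') :
    basis_of fullv X -> basis_of fullv X' ->
  exists A : {linear V -> V'}, bijective A /\ forall i, A (tnth X i) = tnth X'
    i.
Proof.
move=> bX bX'.
have extend (U U' : vectType R) (Y : m.-tuple U) (Y' : m.-tuple U') :
    basis_of fullv Y ->
    exists A : {linear U -> U'}, forall i, A (tnth Y i) = tnth Y' i.
  move=> bY; have [A AY] := linear_of_free Y Y'; exists A => i.
  have {}AY : map A Y = Y' by rewrite AY ?(basis_free bY) ?size_tuple.
  by rewrite (tnth_nth 0 Y') -AY (nth_map 0) ?size_tuple // -tnth_nth.
have cancel_on (U U' : vectType R) (Y : m.-tuple U) (f : {linear U -> U'})
    (g : {linear U' -> U}) :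
    basis_of fullv Y -> (forall i, g (f (tnth Y i)) = tnth Y i) -> cancel f g.
  move=> bY fgY u.
  have Yu : u \in <<Y>>%VS by rewrite (span_basis bY) memvf.
  rewrite (coord_span_tnth Yu) !linear_sum; apply: eq_bigr => i _.
  by rewrite !linearZ /= fgY.
have [A AX] := extend _ _ X X' bX; have [A' AX'] := extend _ _ X' X bX'.
exists A; split=> //; exists A'.
  by apply: cancel_on bX _ => i; rewrite AX AX'.
by apply: cancel_on bX' _ => i; rewrite AX' AX.
Qed.

(** The bracket has the coordinates <Z_i, Z_i> <J_i u, w>. Exchanging the
    signature changes <Z_i, Z_i> to its opposite, and [frame_compare]
    contributes the sign (-1)^c, so Z_i has to be sent to - (-1)^c Z'_i. *)
Lemma integral_isomorphic_of_code (R : realType) (p q : nat)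
    (M : admissible_module R p q) (M' : admissible_module R q p)
    (I : finType) (sg : I -> 'I_(p + q)) (sg' : I -> 'I_(q + p))
    (L : pred {ffun I -> bool}) :
    bijective sg -> bijective sg' ->
    (forall i, (sg' i < q)%N = ~~ (sg i < p)%N) ->
    good_code (fun i => (sg i < p)%N) L ->
    minimal_admissible M -> minimal_admissible M' ->
  integral_isomorphic M M'.
Proof.
move=> sg_bij sg'_bij sgE goodL M_min M'_min.
have sysJ : clifford_system (twist false (fun i => (sg i < p)%N)) (am_form M)
  (generator M sg).
  by apply: clifford_system_ext (generator_system M sg_bij) => i;
    rewrite /twist addbF.
have sysJ' : clifford_system (twist true (fun i => (sg i < p)%N)) (am_form M')
  (generator M' sg').
  by apply: clifford_system_ext (generator_system M' sg'_bij) => i;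
    rewrite /twist addbT sgE.
have [chi [v [v' [g [g' [vE vv vE' vv']]]]]] := matched_eigenvectors goodL sysJ
  sysJ'
  (am_nondegenerate M) (am_nonzero M) (am_nondegenerate M') (am_nonzero M').
pose x := frame_vect (generator M sg) v false.
pose x' := frame_vect (generator M' sg') v' true.
have xF : frame (am_form M) (generator M sg) L (frame_sign _ false) x :=
  frame_vectP goodL sysJ vE vv.
have xF' : frame (am_form M') (generator M' sg') L (frame_sign _ true) x' :=
  frame_vectP goodL sysJ' vE' vv'.
have formE i T U : am_form M' (generator M' sg' i (x' T)) (x' U)
    = (-1) ^+ (g (+) g') * am_form M (generator M sg i (x T)) (x U) :=
  frame_compare goodL sysJ sysJ' vE vv vE' vv' i T U.
clearbody x x'; set c := g (+) g' in formE.
pose X := frame_basis L x; pose X' := frame_basis L x'.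
have bX : basis_of fullv X := minimal_frame_basis sg_bij goodL xF M_min.
have bX' : basis_of fullv X' := minimal_frame_basis sg'_bij goodL xF' M'_min.
pose Z := center_basis R sg false; pose Z' := center_basis R sg' (~~ c).
have [A [A_bij AX]] := basis_isomorphism bX bX'.
have [C [C_bij CZ]] := basis_isomorphism (center_basisP R sg_bij false)
  (center_basisP R sg'_bij (~~ c)).
have Cdelta i : C (delta_mx 0 (sg i)) = (-1) ^+ (~~ c) *: delta_mx 0 (sg' i).
  by have := CZ (enum_rank i); rewrite !tnth_mktuple enum_rankK scale1r.
have A_form i u w : am_form M' (generator M' sg' i (A u)) (A w)
    = (-1) ^+ c * am_form M (generator M sg i u) w.
  have Xu : u \in <<X>>%VS by rewrite (span_basis bX) memvf.
  have Xw : w \in <<X>>%VS by rewrite (span_basis bX) memvf.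
  rewrite (coord_span_tnth Xu) !linear_sum !linear_sumlz mulr_sumr.
  apply: eq_bigr => a _; rewrite !linearZ /= !linearZl_LR /= mulrCA;
    congr (_ * _).
  rewrite (coord_span_tnth Xw) !linear_sum mulr_sumr.
  apply: eq_bigr => b _; rewrite !linearZ /= mulrCA; congr (_ * _).
  by rewrite !AX !tnth_mktuple formE.
pose f (y : pseudoH M) : pseudoH M' := (A y.1, C y.2).
have f_lin : linear f by move=> a y z; rewrite /f /= !linearP.
pose fL := HB.pack_for {linear pseudoH M -> pseudoH M'} f
  (GRing.isLinear.Build _ _ _ _ f f_lin).
exists (coset_count L), #|I|, X, Z, X', Z', fL; split.
- split; first exact: (frame_integral_basis sg_bij goodL xF M_min).
  exact: (frame_integral_basis sg'_bij goodL xF' M'_min).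
- have [[A1 AK KA] [C1 CK KC]] := (A_bij, C_bij).
  exists (fun y : pseudoH M' => (A1 y.1, C1 y.2)) => -[y z].
    by rewrite /= /f /= AK CK.
  by rewrite /= /f /= KA KC.
- move=> y z; rewrite -[LHS]/(A 0, C (brack y.1 z.1)) -[RHS]/(0, brack (A y.1)
    (A z.1)).
  rewrite linear0; congr pair; rewrite (brackE sg_bij) (brackE sg'_bij)
    linear_sum.
  apply: eq_bigr => i _; rewrite linearZ /= Cdelta A_form scalerA;
    congr (_ *: _).
  rewrite [(q <= _)%N]leqNgt sgE negbK ltnNge mulrA mulrAC -!signr_addb.
  by congr ((-1) ^+ _ * _); case: (p <= sg i)%N; case: (c).
- by move=> i; rewrite -[LHS]/(A (tnth X i), C 0) AX linear0.
by move=> k; rewrite -[LHS]/(A 0, C (tnth Z k)) CZ linear0.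
Qed.

Section Indexing.
Variables (p q n K : nat).
Hypothesis pq : (p + q = n + 8 * K)%N.

Definition block_index_nat (i : 'I_n + 'I_K * 'I_8) : nat :=
  match i with inl j => j | inr (j, k) => (n + 8 * j + k)%N end.

Fact block_index_lt i : (block_index_nat i < p + q)%N.
Proof. by rewrite pq; case: i => [j|[j k]] /=; have := ltn_ord j;
  try have := ltn_ord k; lia. Qed.

Definition block_index i : 'I_(p + q) := Ordinal (block_index_lt i).

Lemma block_index_bij : bijective block_index.
Proof.
apply: inj_card_bij; last by rewrite card_sum card_prod !card_ord pq; lia.
move=> i i' /(congr1 val) /=.
case: i i' => [j|[j k]] [j'|[j' k']] /=.
- by move=> /ord_inj ->.
- by have := ltn_ord j; lia.
- by have := ltn_ord j'; lia.
have := ltn_ord k; have := ltn_ord k' => k'8 k8 E.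
by congr (inr (_, _)); apply: ord_inj; lia.
Qed.

End Indexing.

Definition swap_ord p q (i : 'I_(p + q)) : 'I_(q + p) :=
  unsplit (match split i with inl j => inr j | inr j => inl j end).

Lemma swap_ordK p q : cancel (@swap_ord p q) (@swap_ord q p).
Proof. by move=> i; rewrite /swap_ord unsplitK -[RHS]splitK;
  case: (split i). Qed.

Lemma swap_ord_bij p q : bijective (@swap_ord p q).
Proof. by exists (@swap_ord q p); apply: swap_ordK. Qed.

Lemma swap_ord_lt p q (i : 'I_(p + q)) : (swap_ord i < q)%N = ~~ (i < p)%N.
Proof.
rewrite -[in RHS](splitK i) /swap_ord; case: (split i) => j /=.
  by rewrite ltn_ord ltnNge leq_addr.
by rewrite ltn_ord ltnNge leq_addr.
Qed.

Local Close Scope ring_scope.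

Theorem theorem5p9 (R : realType) (r t1 t2 t3 : nat)
    (r_mod8 : r %% 8 \in [:: 0; 1; 2; 4])
    (not_all_zero : ~ [/\ r = 0, t1 = 0, t2 = 0 & t3 = 0])
    (M : admissible_module R (r + 4 * t1 + 8 * t2) (8 * t3 + 4 * t1))
    (M' : admissible_module R (8 * t3 + 4 * t1) (r + 4 * t1 + 8 * t2))
    (M_minimal : minimal_admissible M)
    (M'_minimal : minimal_admissible M') :
  integral_isomorphic M M'.
Proof.
(* The positive generators are the first r %% 8 + 4 (2 (r %/ 8) + t1 + 2 t2),
   so the signature changes at the boundary of two half blocks. *)
have pq : (r + 4 * t1 + 8 * t2 + (8 * t3 + 4 * t1)
    = r %% 8 + 8 * (r %/ 8 + t1 + t2 + t3))%N.
  by rewrite {1}(divn_eq r 8); lia.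
have sg_bij := block_index_bij pq.
apply: (integral_isomorphic_of_code (sg := block_index pq) (sg' := fun i =>
  swap_ord (block_index pq i))
  (L := sum_code (@small_code _) (block_code hamming))) M_minimal M'_minimal =>
    //.
- exact: bij_comp (swap_ord_bij _ _) sg_bij.
- by move=> i; apply: swap_ord_lt.
apply: good_code_sum.
- have e_true i : (block_index pq (inl i) < r + 4 * t1 + 8 * t2)%N = true.
    have /= := ltn_ord i; have := leq_mod r 8; lia.
  have -> : (fun i : 'I_(r %% 8) => (block_index pq (inl i) < r + 4 * t1 + 8 *
    t2)%N) = fun=> true.
    exact: funext.
  exact: good_code_small.
- apply: good_code_block; last exact: self_dual_hamming.
    move=> j; apply: good_code_hamming => k k' /= kk'.
    have := divn_eq r 8; have := ltn_ord k; have := ltn_ord k'; move: kk'; lia.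
  by apply/forallP => c; rewrite ipC ip0l.
apply: self_dual_block; last exact: self_dual_hamming.
by apply/forallP => c; rewrite ipC ip0l.
Qed.
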